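(* Fix $t\in\{0,\dots,\mathcal T\}$ and consider a sequence $\{P_n\}$ of data-generating processes. Suppose that for some functions $p_t^0(x)$ and $\mu_t^0(x)$, $$\mathbb E_n[(\hat p_t(x_i)-p_t^0(x_i))^2]=o_{P_n}(1)\quad\text{and}\quad\mathbb E_n[(\hat\mu_t(x_i)-\mu_t^0(x_i))^2]=o_{P_n}(1).$$ Let (I) and (II) of the context hold for each $n$, with the regularity conditions also holding for $p_t^0(x)$ and $\mu_t^0(x)$. If $p_t^0(x)=p_t(x)$ or $\mu_t^0(x)=\mu_t(x)$, then $|\hat\mu_t-\mu_t|=o_{P_n}(1)$, where $$\hat\mu_t=\frac1n\sum_{i=1}^n\left\{\frac{d_i^t(y_i-\hat\mu_t(x_i))}{\hat p_t(x_i)}+\hat\mu_t(x_i)\right\}.$$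
   Context: **Setting.** For each $n$, $P_n$ is the joint law of $(Y,D,X')'$ and the latent potential outcomes; it may vary with $n$. $D\in\{0,1,\dots,\mathcal T\}$, $\mathcal T\ge1$ fixed; $\{Y(t)\}_{t=0}^{\mathcal T}$ are scalar potential outcomes and $Y=\sum_{t}\mathbf 1\{D=t\}Y(t)$. $p_t(x)=\mathbb P[D=t\mid X=x]$, $\mu_t(x)=\mathbb E[Y\mid D=t,X=x]$, $\mu_t=\mathbb E[Y(t)]$, $U=Y(t)-\mu_t(X)$ (for each $t$), $u_i=y_i-\mu_{d_i}(x_i)$, $d_i^t=\mathbf 1\{d_i=t\}$, $\mathbb E_n[w_i]=\frac1n\sum_{i=1}^nw_i$. $\hat p_t(\cdot)$ and $\hat\mu_t(\cdot)$ are generic first-stage estimators. $X^*$ is a $p$-dimensional transformation of $X$ ($p$ may depend on $n$ and exceed $n$). $o_{P_n}$ has its usual meaning with measure $P_n$ used for each $n$. **(I) Identification.** For all $t$ and almost surely in $X$: (a) $\mathbb E[Y(t)\mid D,X=x]=\mathbb E[Y(t)\mid X=x]$; (b) $\mathbb P[D=t\mid X=x]\ge p_{\min}>0$, with $p_{\min}$ not depending on $n$. **(II) Data generating process**, with all bounds uniform in $n$: (a) $\{(y_i,d_i,x_i')'\}_{i=1}^n$ is an i.i.d. sample from $(Y,D,X')'$. (b) $\max_{j\le p}|X_j^*|\le\mathcal X<\infty$; transformations may depend on $n$ but not on the data-generating process. (c) $\mathbb E[|U|^4\mid X]\le\mathcal U^4$. (d) $\min_{j\le p,\,0\le t\le\mathcal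 T}\ \mathbb E[(X_j^* )^2U^2]\wedge\mathbb E[(X_j^* )^2(\mathbf 1\{D=t\}-p_t(X))^2]$ is bounded away from zero. (e) For some $r>0$, $\mathbb E[|\mu_t(x_i)\mu_{t'}(x_i)|^{1+r}]$ and $\mathbb E[|u_i|^{4+r}]$ are bounded. ''The regularity conditions also holding for $p_t^0,\mu_t^0$'' means that the bounds in (I)(b) and (II)(c)-(e) also hold with $p_t^0$, $\mu_t^0$ and $Y(t)-\mu_t^0(X)$ in place of $p_t$, $\mu_t$ and $U$.
   Formalization: Added hypothesis: max_{i≤n} 1{d_i=t}/|p̂_t(x_i)| = O_{P_n}(1), i.e. fitted propensities at observations with d_i=t stay away from 0 in probability; without it the claim fails, e.g. if p̂_t(x_1)=1/n and p̂_t is exact elsewhere. *)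

(* Defs.v *)
From HB Require Import structures.
From mathcomp Require Import all_boot all_order all_algebra.
From mathcomp Require Import all_classical all_reals all_analysis.

Set Implicit Arguments.
Unset Strict Implicit.
Unset Printing Implicit Defensive.

Import Order.TTheory GRing.Theory Num.Theory.
Import numFieldNormedType.Exports.

Local Open Scope classical_set_scope.
Local Open Scope ring_scope.

(* f is a version of E[W | Z = .]; the event B ranges over sigma(Z) through
   preimages. *)
Definition is_cond_exp (R : realType) (d d' : measure_display)
    (Om : measurableType d) (V : measurableType d') (P : probability Om R)
    (Z : Om -> V) (W : Om -> R) (f : V -> R) : Prop :=
  [/\ measurable_fun [set: V] f,
      P.-integrable [set: Om] (EFin \o W),
      P.-integrable [set: Om] (EFin \o (f \o Z)) &
      forall B : set V, measurable B ->
        (\int[P]_(w in Z @^-1` B) (W w)%:E =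
         \int[P]_(w in Z @^-1` B) (f (Z w))%:E)%E].

Notation covariates R k := (k.-tuple (measurableTypeR R)).
Notation observation R k := (measurableTypeR R * nat * covariates R k)%type.

(* One element of the sequence {P_n}: a probability space carrying both the
   population variables (Y(0), ..., Y(T), D, X) and a sample of n observations
   (y_i, d_i, x_i). The treatment levels {0, ..., T} are encoded in nat;
   potential outcomes with index above T are junk and never constrained. *)
Record dgp (R : realType) (T k n : nat) := Dgp {
  dgp_disp : measure_display ;
  sample_space : measurableType dgp_disp ;
  dgp_law : probability sample_space R ;
  potential : nat -> {RV dgp_law >-> measurableTypeR R} ;
  treatment : {RV dgp_law >-> nat} ;
  covariate : {RV dgp_law >-> covariates R k} ;
  sample : 'I_n -> {RV dgp_law >-> observation R k} ;
  treatment_le : forall w, (treatment w <= T)%N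
}.

Section one_dgp.
Context {R : realType} {T k n : nat} (M : dgp R T k n).

Definition outcome (w : sample_space M) : R :=
  \sum_(s < T.+1) (treatment M w == s)%:R * potential M s w.

Definition treatment_covariate (w : sample_space M) : nat * covariates R k :=
  (treatment M w, covariate M w).

Definition population (w : sample_space M) : observation R k :=
  (outcome w : measurableTypeR R, treatment M w, covariate M w).

Definition y_ (i : 'I_n) (w : sample_space M) : R := (sample M i w).1.1.
Definition d_ (i : 'I_n) (w : sample_space M) : nat := (sample M i w).1.2.
Definition x_ (i : 'I_n) (w : sample_space M) : covariates R k := (sample M i w).2.

(* Sub-families of sets in the product rule are obtained with A i := setT. *)
Definition iid_sample : Prop :=
  (forall (i : 'I_n) (A : set (observation R k)), measurable A ->
     dgp_law M (sample M i @^-1` A) = dgp_law M (population @^-1` A)) /\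
  (forall A : 'I_n -> set (observation R k), (forall i, measurable (A i)) ->
     dgp_law M [set w | forall i, A i (sample M i w)] =
     (\prod_(i < n) dgp_law M (sample M i @^-1` A i))%E).

Definition is_propensity (p : nat -> covariates R k -> R) : Prop :=
  forall s, (s <= T)%N ->
    is_cond_exp (dgp_law M) (covariate M)
      (fun w => (treatment M w == s)%:R) (p s).

Definition is_regression (mu : nat -> covariates R k -> R) : Prop :=
  is_cond_exp (dgp_law M) treatment_covariate outcome (fun z => mu z.1 z.2).

Definition unconfounded : Prop :=
  forall s, (s <= T)%N ->
    exists (g : covariates R k -> R) (h : nat * covariates R k -> R),
      [/\ is_cond_exp (dgp_law M) (covariate M) (potential M s) g,
          is_cond_exp (dgp_law M) treatment_covariate (potential M s) h &
          {ae dgp_law M, forall w, h (treatment_covariate w) = g (covariate M w)}].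

Definition residual (mu : nat -> covariates R k -> R) (s : nat)
  (w : sample_space M) : R := potential M s w - mu s (covariate M w).

Definition sample_residual (mu : nat -> covariates R k -> R) (i : 'I_n)
  (w : sample_space M) : R := y_ i w - mu (d_ i w) (x_ i w).

Definition sample_mse (f : sample_space M -> covariates R k -> R)
    (g : covariates R k -> R) (w : sample_space M) : R :=
  n%:R^-1 * \sum_(i < n) (f w (x_ i w) - g (x_ i w)) ^+ 2.

Definition mean_estimator (t : nat)
    (phat muhat : sample_space M -> covariates R k -> R) (w : sample_space M) : R :=
  n%:R^-1 * \sum_(i < n)
    ((d_ i w == t)%:R * (y_ i w - muhat w (x_ i w)) / phat w (x_ i w)
     + muhat w (x_ i w)).

Definition mean_potential (t : nat) : R := fine ('E_(dgp_law M)[potential M t])%E.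

End one_dgp.

Section sequences.
Context {R : realType} {T : nat} {k : nat -> nat}.
Variable M : forall n, dgp R T (k n) n.

Definition o_P1 (Z : forall n, sample_space (M n) -> R) : Prop :=
  forall eps : R, 0 < eps ->
    (fun n => dgp_law (M n) [set w | eps < `|Z n w|]) @ \oo --> 0%E.

(* A random function of the covariates, arbitrary except that its values at the
   sample points are random variables; functions built from the sample (and
   possibly from auxiliary randomness) are the intended case. *)
Definition first_stage_estimator
    (f : forall n, sample_space (M n) -> covariates R (k n) -> R) : Prop :=
  forall n (i : 'I_n),
    measurable_fun [set: sample_space (M n)] (fun w => f n w (x_ i w) : R).

(* max_i 1{d_i = t} / |phat(x_i)| = O_P(1), written without division (1 / 0 is 0
   in MathComp). The empirical mean square error of phat does not control this:
   a single fitted value of order 1/n changes the mean square error by O(1/n)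
   but the inverse-weighted average by O(1). *)
Definition inverse_weights_bounded (t : nat)
    (phat : forall n, sample_space (M n) -> covariates R (k n) -> R) : Prop :=
  forall delta : R, 0 < delta -> exists2 c : R, 0 < c &
    \forall n \near \oo,
      (dgp_law (M n) [set w | exists i : 'I_n,
         d_ i w = t /\ (`|phat n w (x_ i w)| < c)%R] <= delta%:E)%E.

Section regularity.
Variables (q : nat -> nat)
  (Xstar : forall n, 'I_(q n) -> {mfun covariates R (k n) >-> measurableTypeR R}).

Definition transformations_bounded : Prop :=
  exists B : R, forall n (j : 'I_(q n)),
    {ae dgp_law (M n), forall w, `|Xstar j (covariate (M n) w)| <= B}.

Variables p mu : forall n, nat -> covariates R (k n) -> R.
Arguments p : clear implicits.
Arguments mu : clear implicits.

Definition overlap : Prop :=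
  exists2 pmin : R, 0 < pmin & forall n s, (s <= T)%N ->
    {ae dgp_law (M n), forall w, pmin <= p n s (covariate (M n) w)}.

Definition cond_fourth_moment_bounded : Prop :=
  exists B : R, forall n s, (s <= T)%N ->
    exists2 v : covariates R (k n) -> R,
      is_cond_exp (dgp_law (M n)) (covariate (M n))
        (fun w => `|residual (mu n) s w| ^+ 4) v &
      {ae dgp_law (M n), forall w, v (covariate (M n) w) <= B ^+ 4}.

Definition variances_bounded_away : Prop :=
  exists2 c : R, 0 < c & forall n (j : 'I_(q n)) s, (s <= T)%N ->
    (c%:E <= 'E_(dgp_law (M n))[fun w =>
       (Xstar j (covariate (M n) w) ^+ 2 * residual (mu n) s w ^+ 2)%R])%E /\
    (c%:E <= 'E_(dgp_law (M n))[fun w =>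
       (Xstar j (covariate (M n) w) ^+ 2 *
        ((treatment (M n) w == s)%:R - p n s (covariate (M n) w)) ^+ 2)%R])%E.

Definition moments_bounded : Prop :=
  exists2 r : R, 0 < r & exists B : R, forall n (i : 'I_n),
    (forall s s', (s <= T)%N -> (s' <= T)%N ->
       ('E_(dgp_law (M n))[fun w =>
          (`|mu n s (x_ i w) * mu n s' (x_ i w)| `^ (1 + r))%R] <= B%:E)%E) /\
    ('E_(dgp_law (M n))[fun w =>
       (`|sample_residual (mu n) i w| `^ (4 + r))%R] <= B%:E)%E.

Definition regularity : Prop :=
  [/\ overlap, cond_fourth_moment_bounded,
      variances_bounded_away & moments_bounded].

End regularity.
End sequences.

Definition replace_at (A B : Type) (t : nat) (f0 : A -> B)
  (F : nat -> A -> B) (s : nat) : A -> B := if s == t then f0 else F s.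

(* Main.v *)
Require Import Defs.
From HB Require Import structures.
From mathcomp Require Import all_boot all_order all_algebra.
From mathcomp Require Import all_classical all_reals all_analysis.
From mathcomp Require Import measurable_realfun.
From mathcomp Require Import ring lra.

Set Implicit Arguments.
Unset Strict Implicit.
Unset Printing Implicit Defensive.

Import Order.TTheory GRing.Theory Num.Theory.
Import numFieldNormedType.Exports.

Local Open Scope classical_set_scope.
Local Open Scope ring_scope.

(** Write a for the indicator of D = t and let
      psi = a (Y - mu0 X) / p0 X + mu0 X
    be the score built from the limits of the two first stages. The estimator
    is the sample average of the same expression with phat, muhat in place of
    p0, mu0, and three facts make it consistent.

    First, psi has mean E[Y(t)] as soon as one limit is the true one
    ([double_robustness]). Unconfoundedness gives, for every weight q bounded
    away from zero,
      E[a Y / q X] = E[a E[Y(t) | X] / q X] = E[a mu_t X / q X],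
    and the weight q = p undoes the selection: E[a f(X) / p X] = E[f(X)].
    If p0 = p, this turns E[psi] into E[Y(t)] - E[mu0 X] + E[mu0 X]. If
    mu0 = mu_t, the weighted residual has mean zero whatever p0 is, and
    E[mu_t X] = E[a mu_t X / p X] = E[a Y / p X] = E[Y(t)].

    Second, the second moment of psi is bounded uniformly in n, because p0 is
    bounded below and mu0 and Y(t) - mu0 X have bounded second moments
    ([score_second_moment]). Independence makes the centred scores
    uncorrelated, so Chebyshev's inequality bounds the deviation of their
    average by a constant times 1 / n ([iid_average_concentration]).

    Third, replacing p0, mu0 by phat, muhat moves the average by little
    ([average_perturbation]). On the event where |phat| >= c at all treated
    points, a summand changes by at most
      |phat - p0| a |Y - mu0 X| / (c pmin) + (1 + 1/c) |muhat - mu0|,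
    and Young's inequality with weight lam turns the average of this into
    lam times a quantity bounded in probability plus 1 / lam times the two
    mean square errors. The constants are therefore chosen in the order c,
    then the bound K on the average of a (Y - mu0 X)^2, then lam, and last the
    size required of the mean square errors.

    Conditional expectations and independence both enter through products of
    a function of Z with a variable that integrates to zero over every event
    of sigma(Z); [null_pull_out] deals with these products once and for all. *)

(** * Integrals on a probability space *)

(** Writing 1 / f as f (f^2)^(-1) reduces the claim to real powers of a
    nonnegative base; the formula also holds where f vanishes, as 1 / 0 = 0. *)
Lemma measurable_funV d (T : measurableType d) (R : realType) (f : T -> R) :
  measurable_fun setT f -> measurable_fun setT (fun x => (f x)^-1).
Proof.
move=> mf.
have -> : (fun x => (f x)^-1) = (fun x => f x * (f x ^+ 2) `^ (-1)).
  apply/funext => x; rewrite powR_inv1 ?sqr_ge0//.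
  have [->|fx0] := eqVneq (f x) 0; first by rewrite invr0 mul0r.
  by field.
apply: measurable_funM => //.
exact: (measurableT_comp (measurable_powR (-1)) (measurable_funX 2 mf)).
Qed.

Section integrals.
Context d (Om : measurableType d) (R : realType) (P : probability Om R).
Implicit Types (f g : Om -> R).

Lemma integrable_measurable f :
  P.-integrable setT (EFin \o f) -> measurable_fun setT f.
Proof. by move=> /(measurable_int P) /measurable_EFinP. Qed.

Lemma ae_le_integrable f g : measurable_fun setT f ->
  P.-integrable setT (EFin \o g) ->
  {ae P, forall w, `|f w| <= `|g w|} -> P.-integrable setT (EFin \o f).
Proof.
move=> mf ig fg; apply/integrableP; split; first exact/measurable_EFinP.
have [mg goo] := integrableP _ _ _ ig.
apply: le_lt_trans goo; apply: ae_ge0_le_integral => //.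
- by apply: measurableT_comp => //; exact/measurable_EFinP.
- exact: measurableT_comp.
- by apply: filterS fg => w fgw _ /=; rewrite lee_fin.
Qed.

Lemma ae_eq_Rintegral f g : measurable_fun setT f -> measurable_fun setT g ->
  {ae P, forall w, f w = g w} -> \int[P]_w f w = \int[P]_w g w.
Proof.
move=> mf mg fg; congr fine; apply: ae_eq_integral => //.
- exact/measurable_EFinP.
- exact/measurable_EFinP.
- by apply: filterS fg => w /= -> .
Qed.

Lemma EFin_Rintegral f : P.-integrable setT (EFin \o f) ->
  (\int[P]_w f w)%:E = (\int[P]_w (f w)%:E)%E.
Proof. by move=> fi; rewrite fineK//; exact: integrable_fin_num. Qed.

Lemma bounded_integral_integrable f (C : R) : measurable_fun setT f ->
  (forall w, 0 <= f w) -> (\int[P]_w (f w)%:E <= C%:E)%E ->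
  P.-integrable setT (EFin \o f) /\ \int[P]_w f w <= C.
Proof.
move=> mf f0 fC.
have fi : P.-integrable setT (EFin \o f).
  apply/integrableP; split; first exact/measurable_EFinP.
  under eq_integral do rewrite /= ger0_norm//.
  exact: le_lt_trans fC (ltry _).
by split => //; rewrite -lee_fin EFin_Rintegral.
Qed.

Lemma integrable_EFinD f g : P.-integrable setT (EFin \o f) ->
  P.-integrable setT (EFin \o g) ->
  P.-integrable setT (EFin \o (fun w => f w + g w)).
Proof. by move=> fi gi; exact: (integrableD measurableT fi gi). Qed.

Lemma integrable_EFinB f g : P.-integrable setT (EFin \o f) ->
  P.-integrable setT (EFin \o g) ->
  P.-integrable setT (EFin \o (fun w => f w - g w)).
Proof. by move=> fi gi; exact: (integrableB measurableT fi gi). Qed.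

Lemma integrable_EFinZ (c : R) f : P.-integrable setT (EFin \o f) ->
  P.-integrable setT (EFin \o (fun w => c * f w)).
Proof. by move=> fi; exact: (integrableZl measurableT c fi). Qed.

Lemma integrable_EFin_cst (c : R) : P.-integrable setT (EFin \o (fun=> c)).
Proof. exact: finite_measure_integrable_cst. Qed.

Lemma Rintegral_prob_cst (c : R) : \int[P]_w c = c.
Proof.
have P1 : fine (P setT) = 1 by rewrite probability_setT.
by rewrite Rintegral_cst// [fine _]P1 mulr1.
Qed.

Lemma integrable_EFin_sum (I : Type) (s : seq I) (F : I -> Om -> R) :
  (forall i, P.-integrable setT (EFin \o F i)) ->
  P.-integrable setT (EFin \o (fun w => \sum_(i <- s) F i w)).
Proof.
move=> Fi; have := integrable_sum measurableT s (P := xpredT) (fun i _ => Fi i).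
by apply: eq_integrable => // w _ /=; rewrite sumEFin.
Qed.

Lemma Rintegral_sum (I : Type) (s : seq I) (F : I -> Om -> R) :
  (forall i, P.-integrable setT (EFin \o F i)) ->
  \int[P]_w (\sum_(i <- s) F i w) = \sum_(i <- s) \int[P]_w F i w.
Proof.
move=> Fi; elim: s => [|i s ih].
  by under eq_Rintegral do rewrite big_nil; rewrite big_nil Rintegral_prob_cst.
under eq_Rintegral do rewrite big_cons.
by rewrite big_cons RintegralD// ?ih//; exact: integrable_EFin_sum.
Qed.

Lemma square_integrable_mul f g :
  measurable_fun setT f -> measurable_fun setT g ->
  P.-integrable setT (EFin \o (fun w => f w ^+ 2)) ->
  P.-integrable setT (EFin \o (fun w => g w ^+ 2)) ->
  P.-integrable setT (EFin \o (fun w => f w * g w)).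
Proof.
move=> mf mg f2 g2; apply: (ae_le_integrable _ (integrable_EFinD f2 g2)).
  exact: measurable_funM.
apply: aeW => w; rewrite [leRHS]ger0_norm ?addr_ge0 ?sqr_ge0//.
rewrite ler_norml; apply/andP; split.
- have := sqr_ge0 (f w + g w); have := sqr_ge0 (f w); have := sqr_ge0 (g w); nra.
- have := sqr_ge0 (f w - g w); have := sqr_ge0 (f w); have := sqr_ge0 (g w); nra.
Qed.

Lemma square_integrable_integrable f : measurable_fun setT f ->
  P.-integrable setT (EFin \o (fun w => f w ^+ 2)) ->
  P.-integrable setT (EFin \o f).
Proof.
move=> mf f2.
have := @square_integrable_mul f (cst 1) mf (measurable_cst _) f2
  (integrable_EFin_cst (1 ^+ 2)).
by apply: eq_integrable => // w _ /=; rewrite mulr1.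
Qed.

Lemma markov_ge0 f (C K : R) : measurable_fun setT f -> 0 < K ->
  (forall w, 0 <= f w) -> (\int[P]_w (f w)%:E <= C%:E)%E ->
  (P [set w | (K < f w)%R] <= (C / K)%:E)%E.
Proof.
move=> mf K0 f0 fC.
have mEf : measurable_fun setT (EFin \o f) by exact/measurable_EFinP.
rewrite EFinM lee_pdivlMr//.
apply: le_trans (le_trans _ fC); last first.
  have := le_integral_abse P measurableT mEf K0.
  under eq_integral do rewrite /= ger0_norm//.
  by apply.
rewrite muleC lee_pmul2l//=; apply: le_measure; rewrite ?inE.
- rewrite -[X in measurable X]setTI.
  rewrite (_ : [set w | _] = f @^-1` `]K, +oo[%classic); first exact: mf.
  by apply/seteqP; split => w /=; rewrite in_itv/= andbT.
- apply: emeasurable_fun_c_infty => //.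
  by apply/measurable_EFinP; exact: measurableT_comp.
- by move=> w /= Kf; split => //; rewrite lee_fin ger0_norm// ltW.
Qed.

End integrals.

Lemma ae_le_Rintegral d (Om : measurableType d) (R : realType)
    (P : probability Om R) (f g : Om -> R) :
  P.-integrable setT (EFin \o f) -> P.-integrable setT (EFin \o g) ->
  {ae P, forall w, f w <= g w} -> \int[P]_w f w <= \int[P]_w g w.
Proof.
move=> fi gi fg; rewrite -subr_ge0 -RintegralB//.
have bi := integrable_EFinB gi fi.
rewrite (ae_eq_Rintegral (g := fun w => `|g w - f w|)).
- by apply: Rintegral_ge0.
- exact: integrable_measurable bi.
- by apply: measurableT_comp => //; exact: integrable_measurable bi.
- by apply: filterS fg => w fgw; rewrite ger0_norm// subr_ge0.
Qed.

(** Used with g a higher power of f: moments of higher order bound those of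
    lower order with constants that depend on nothing else. *)
Lemma integrable_le_1D d (Om : measurableType d) (R : realType)
    (P : probability Om R) (f g : Om -> R) (B : R) :
  measurable_fun setT f -> measurable_fun setT g ->
  (forall w, 0 <= f w) -> (forall w, 0 <= g w) -> (forall w, f w <= 1 + g w) ->
  (\int[P]_w (g w)%:E <= B%:E)%E ->
  P.-integrable setT (EFin \o f) /\ \int[P]_w f w <= 1 + B.
Proof.
move=> mf mg f0 g0 fg gB; apply: bounded_integral_integrable => //.
apply: (@le_trans _ _ (\int[P]_w (1%:E + (g w)%:E))%E).
  apply: ge0_le_integral => //.
  - by move=> w _; rewrite lee_fin.
  - exact/measurable_EFinP.
  - by apply: emeasurable_funD => //; exact/measurable_EFinP.
  - by move=> w _; rewrite -EFinD lee_fin.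
have mEg : measurable_fun setT (EFin \o g) by exact/measurable_EFinP.
rewrite ge0_integralD//; last first.
  by move=> w _; rewrite lee_fin.
have PT : P setT = 1%E by exact: probability_setT.
by rewrite integral_cst// [X in (_ * X)%E]PT mule1 EFinD leeD2l.
Qed.

Lemma cvge0P (R : realType) (u : (\bar R)^nat) : (forall n, 0 <= u n)%E ->
  u @ \oo --> 0%E <->
  forall delta : R, 0 < delta -> \forall n \near \oo, (u n <= delta%:E)%E.
Proof.
move=> u0; split.
  move=> /fine_cvgP[ufin /cvgrPdist_le ucvg] delta /ucvg; apply: filterS2 ufin => n un.
  rewrite /= sub0r normrN => h; rewrite -(fineK un) lee_fin.
  exact: le_trans (ler_norm _) h.
move=> ud.
have ufin : \forall n \near \oo, u n \is a fin_num.
  apply: filterS (ud 1 ltr01) => n un.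
  by rewrite ge0_fin_numE//; exact: le_lt_trans un (ltry _).
apply/fine_cvgP; split => //; apply/cvgrPdist_le => e /ud.
apply: filterS2 ufin => n un /= une; rewrite sub0r normrN.
by rewrite ger0_norm ?fine_ge0// -lee_fin fineK.
Qed.

(** * Conditional expectation, equality in law, independence *)

Section pull_out.
Context d d' (Om : measurableType d) (V : measurableType d') (R : realType).
Context (P : probability Om R) (Z : Om -> V).
Hypothesis mZ : measurable_fun setT Z.

Lemma Rintegral_preimage (B : set V) (f : Om -> R) :
  \int[P]_(w in Z @^-1` B) f w = \int[P]_w (\1_B (Z w) * f w).
Proof.
rewrite Rintegral_mkcond; apply: eq_Rintegral => w _.
rewrite patchE indicE (_ : (w \in Z @^-1` B) = (Z w \in B))//.
by case: (Z w \in B); rewrite ?mul1r ?mul0r.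
Qed.

Lemma integrable_indic_mul (B : set V) (f : Om -> R) : measurable B ->
  P.-integrable setT (EFin \o f) ->
  P.-integrable setT (EFin \o (fun w => \1_B (Z w) * f w)).
Proof.
move=> mB fi; apply: (ae_le_integrable _ fi).
  apply: measurable_funM; last exact: integrable_measurable fi.
  by apply: (measurableT_comp _ mZ); exact: measurable_indic.
apply: aeW => w; rewrite indicE normrM.
by case: (_ \in _); rewrite ?normr1 ?mul1r// normr0 mul0r.
Qed.

Section null.
Variable f : Om -> R.
Hypothesis fi : P.-integrable setT (EFin \o f).
Hypothesis f0 : forall B, measurable B -> \int[P]_(w in Z @^-1` B) f w = 0.

Import HBNNSimple.

Let null_nnsfun (g : {nnsfun V >-> R}) : \int[P]_w (g (Z w) * f w) = 0.
Proof.
under eq_Rintegral => w _.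
  rewrite fimfunE fsbig_finite//= mulr_suml.
  under eq_bigr do rewrite -mulrA.
  over.
have mg y : measurable (g @^-1` [set y]).
  by rewrite -[X in measurable X]setTI; exact: (measurable_funPT g).
have iB y : P.-integrable setT
    (EFin \o (fun w => \1_(g @^-1` [set y]) (Z w) * f w)).
  exact: integrable_indic_mul.
rewrite Rintegral_sum; last by move=> y; exact: integrable_EFinZ.
rewrite big1// => y _.
by rewrite RintegralZl// -Rintegral_preimage f0// mulr0.
Qed.

Let null_ge0 (h : V -> R) : measurable_fun setT h -> (forall v, 0 <= h v) ->
  P.-integrable setT (EFin \o (fun w => h (Z w) * f w)) ->
  \int[P]_w (h (Z w) * f w) = 0.
Proof.
move=> mh h0 hfi.
have mEh : measurable_fun setT (EFin \o h) by exact/measurable_EFinP.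
have Eh0 v : setT v -> (0 <= (EFin \o h) v)%E by rewrite /= lee_fin.
pose g := nnsfun_approx measurableT mEh.
have gh n v : g n v <= h v.
  by rewrite -lee_fin /g nnsfun_approxE; exact: le_approx.
have mgf n : measurable_fun setT (fun w => (g n (Z w) * f w)%:E).
  apply/measurable_EFinP; apply: measurable_funM.
    exact: (measurableT_comp (measurable_funPT (g n)) mZ).
  exact: integrable_measurable fi.
have cg w : setT w ->
    (fun n => (g n (Z w) * f w)%:E) @ \oo --> (h (Z w) * f w)%:E.
  move=> _; under eq_fun do rewrite EFinM; rewrite EFinM.
  apply: cvgeMr => //.
  exact: (cvg_nnsfun_approx measurableT mEh Eh0 (x := Z w) I).
have dom n w : setT w ->
    (`|(g n (Z w) * f w)%:E| <= `|(h (Z w) * f w)%:E|)%E.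
  move=> _; rewrite lee_fin !normrM ler_wpM2r//.
  by rewrite !ger0_norm//.
have := dominated_cvg measurableT mgf cg _ (integrable_abse hfi) dom.
move=> /(_ (fun _ _ => isT)) /cvg_lim.
rewrite /Rintegral => <-//; rewrite (_ : (fun n => _) = cst 0%E).
  by rewrite lim_cst.
apply/funext => n /=; rewrite -EFin_Rintegral ?null_nnsfun//.
apply: (le_integrable measurableT (mgf n) _ (integrable_abse hfi)).
by move=> w /dom; rewrite abse_id; apply.
Qed.

(** A variable f that integrates to zero over every event of sigma(Z) is
    orthogonal to every function of Z: for simple functions by linearity, for
    nonnegative ones by dominated convergence (the approximations increase to
    h, so |h(Z) f| dominates), and in general by splitting h. *)
Lemma null_pull_out (h : V -> R) : measurable_fun setT h ->
  P.-integrable setT (EFin \o (fun w => h (Z w) * f w)) ->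
  \int[P]_w (h (Z w) * f w) = 0.
Proof.
move=> mh hfi.
have mhp : measurable_fun setT h^\+ by exact: measurable_funrpos.
have mhn : measurable_fun setT h^\- by exact: measurable_funrneg.
have mf := integrable_measurable fi.
have pi : P.-integrable setT (EFin \o (fun w => h^\+ (Z w) * f w)).
  apply: (ae_le_integrable _ hfi).
    by apply: measurable_funM => //; exact: (measurableT_comp mhp mZ).
  apply: aeW => w; rewrite !normrM ler_wpM2r// ger0_norm ?funrpos_ge0//.
  by rewrite /funrpos ge_max ler_norm normr_ge0.
have ni : P.-integrable setT (EFin \o (fun w => h^\- (Z w) * f w)).
  apply: (ae_le_integrable _ hfi).
    by apply: measurable_funM => //; exact: (measurableT_comp mhn mZ).
  apply: aeW => w; rewrite !normrM ler_wpM2r// ger0_norm ?funrneg_ge0//.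
  by rewrite /funrneg ge_max normr_ge0 -normrN ler_norm.
under eq_Rintegral => w _.
  rewrite -[in h (Z w)](funrposBneg h) mulrBl; over.
by rewrite RintegralB// !null_ge0 ?subrr.
Qed.

End null.

(** E[h(Z) W] = E[h(Z) E[W | Z]], since W - E[W | Z] integrates to zero over
    the events of sigma(Z). *)
Lemma cond_exp_pull_out (W : Om -> R) (f h : V -> R) :
  is_cond_exp P Z W f -> measurable_fun setT h ->
  P.-integrable setT (EFin \o (fun w => h (Z w) * W w)) ->
  P.-integrable setT (EFin \o (fun w => h (Z w) * f (Z w))) ->
  \int[P]_w (h (Z w) * W w) = \int[P]_w (h (Z w) * f (Z w)).
Proof.
move=> [mf Wi fi Wf] mh hW hf; apply/eqP; rewrite -subr_eq0 -RintegralB//.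
under eq_Rintegral do rewrite -mulrBr.
rewrite (null_pull_out (f := fun w => W w - f (Z w)))//.
- exact: integrable_EFinB.
- move=> B mB; rewrite RintegralB//.
  + by rewrite /Rintegral Wf// subrr.
  + rewrite -[X in measurable X]setTI; exact: mZ.
  + apply: integrableS Wi => //; rewrite -[X in measurable X]setTI; exact: mZ.
  + apply: integrableS fi => //; rewrite -[X in measurable X]setTI; exact: mZ.
- by have := integrable_EFinB hW hf; apply: eq_integrable => // w _ /=; rewrite mulrBr.
Qed.

End pull_out.

Section same_law.
Context d d' (Om : measurableType d) (V : measurableType d') (R : realType).
Context (P : probability Om R) (X Y : Om -> V).
Hypotheses (mX : measurable_fun setT X) (mY : measurable_fun setT Y).
Hypothesis XY : forall A, measurable A -> P (X @^-1` A) = P (Y @^-1` A).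

Lemma same_law_ge0_integral (f : V -> \bar R) : measurable_fun setT f ->
  (forall v, 0 <= f v)%E ->
  (\int[P]_w f (X w) = \int[P]_w f (Y w))%E.
Proof.
move=> mf f0.
have := ge0_integral_pushforward mX P measurableT mf (fun v _ => f0 v).
have := ge0_integral_pushforward mY P measurableT mf (fun v _ => f0 v).
rewrite !preimage_setT => <- <-.
by apply: eq_measure_integral => A mA _ /=; rewrite /pushforward XY.
Qed.

Lemma same_law_integrable (f : V -> R) : measurable_fun setT f ->
  P.-integrable setT (EFin \o (fun w => f (Y w))) ->
  P.-integrable setT (EFin \o (fun w => f (X w))).
Proof.
move=> mf /integrableP[_ fY]; apply/integrableP; split.
  by apply/measurable_EFinP; exact: (measurableT_comp mf mX).
rewrite (same_law_ge0_integral (f := fun v => `|(f v)%:E|%E))//.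
by apply/measurable_EFinP; exact: measurableT_comp.
Qed.

Lemma same_law_Rintegral (f : V -> R) : measurable_fun setT f ->
  P.-integrable setT (EFin \o (fun w => f (Y w))) ->
  \int[P]_w f (X w) = \int[P]_w f (Y w).
Proof.
move=> mf fY; have fX := same_law_integrable mf fY.
have mEf : measurable_fun setT (EFin \o f) by exact/measurable_EFinP.
have := integral_pushforward mX (mu := P) (D := setT) mEf fX measurableT.
have := integral_pushforward mY (mu := P) (D := setT) mEf fY measurableT.
rewrite !preimage_setT /Rintegral => <- <-; congr fine.
by apply: eq_measure_integral => A mA _ /=; rewrite /pushforward XY.
Qed.

End same_law.

Lemma same_law_ae d d' (Om : measurableType d) (V : measurableType d')
    (R : realType) (P : probability Om R) (X Y : Om -> V) (A : set V) :
  measurable_fun setT X -> measurable_fun setT Y ->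
  (forall B, measurable B -> P (X @^-1` B) = P (Y @^-1` B)) ->
  measurable A -> {ae P, forall w, A (Y w)} -> {ae P, forall w, A (X w)}.
Proof.
move=> mX mY XY mA AY.
have mAC : measurable (~` A) by exact: measurableC.
have mp (Z : Om -> V) : measurable_fun setT Z -> measurable (Z @^-1` (~` A)).
  by move=> mZ; rewrite -[X in measurable X]setTI; exact: mZ.
have /negligibleP : P.-negligible (Y @^-1` (~` A)) by exact: AY.
move=> /(_ (mp _ mY)) PY.
by apply/negligibleP; [exact: mp|exact: etrans (XY _ mAC) PY].
Qed.

Section independence.
Context d d1 d2 (Om : measurableType d) (V1 : measurableType d1)
  (V2 : measurableType d2) (R : realType).
Context (P : probability Om R) (X : Om -> V1) (Y : Om -> V2).
Hypotheses (mX : measurable_fun setT X) (mY : measurable_fun setT Y).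
Hypothesis indep : forall A B, measurable A -> measurable B ->
  (P (X @^-1` A `&` Y @^-1` B) = P (X @^-1` A) * P (Y @^-1` B))%E.

Let mpX A : measurable A -> measurable (X @^-1` A).
Proof. by move=> mA; rewrite -[X in measurable X]setTI; exact: mX. Qed.

Let mpY B : measurable B -> measurable (Y @^-1` B).
Proof. by move=> mB; rewrite -[X in measurable X]setTI; exact: mY. Qed.

(** Independence says that constants are versions of conditional
    expectations: first of the indicators of X given Y, then of g(Y) given X.
    Pulling out twice thus gives the product rule for expectations. *)
Let indicator_given_Y (A : set V1) : measurable A ->
  is_cond_exp P Y (fun w => \1_A (X w)) (fun=> fine (P (X @^-1` A))).
Proof.
move=> mA; split; first exact: measurable_cst.
- rewrite (_ : _ \o _ = EFin \o \1_(X @^-1` A))//.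
  exact: (integrable_indic P (mpX mA)).
- exact: integrable_EFin_cst.
- move=> B mB; rewrite integral_cst; last exact: mpY.
  rewrite fineK; last exact: fin_num_measure P _ (mpX mA).
  rewrite -indep// -integral_indic//; last 2 first.
  + exact: mpY.
  + exact: mpX.
Qed.

Let Rintegral_indic_mul (A : set V1) (g : V2 -> R) : measurable A ->
  measurable_fun setT g -> P.-integrable setT (EFin \o (fun w => g (Y w))) ->
  \int[P]_w (\1_A (X w) * g (Y w)) = fine (P (X @^-1` A)) * \int[P]_w g (Y w).
Proof.
move=> mA mg gi.
under eq_Rintegral do rewrite mulrC.
rewrite (cond_exp_pull_out mY (indicator_given_Y mA) mg).
- by rewrite RintegralZr// mulrC.
- have := integrable_indic_mul mX mA gi.
  by apply: eq_integrable => // w _ /=; rewrite mulrC.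
- have := integrable_EFinZ (fine (P (X @^-1` A))) gi.
  by apply: eq_integrable => // w _ /=; rewrite mulrC.
Qed.

Lemma independent_Rintegral_mul (f : V1 -> R) (g : V2 -> R) :
  measurable_fun setT f -> measurable_fun setT g ->
  P.-integrable setT (EFin \o (fun w => f (X w))) ->
  P.-integrable setT (EFin \o (fun w => g (Y w))) ->
  P.-integrable setT (EFin \o (fun w => f (X w) * g (Y w))) ->
  \int[P]_w (f (X w) * g (Y w)) = \int[P]_w f (X w) * \int[P]_w g (Y w).
Proof.
move=> mf mg fi gi fgi.
have g_given_X : is_cond_exp P X (fun w => g (Y w)) (fun=> \int[P]_w g (Y w)).
  split => //; [exact: integrable_EFin_cst|move=> A mA].
  rewrite integral_cst; last exact: mpX.
  have gA : P.-integrable (X @^-1` A) (EFin \o (fun w => g (Y w))).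
    by apply: integrableS gi => //; exact: mpX.
  rewrite -[LHS]fineK; last first.
    by apply: integrable_fin_num gA; exact: mpX.
  rewrite -/(Rintegral _ _ _) Rintegral_preimage Rintegral_indic_mul//.
  have PA : (fine (P (X @^-1` A)))%:E = P (X @^-1` A).
    by rewrite fineK//; exact: fin_num_measure P _ (mpX mA).
  by rewrite mulrC EFinM PA.
rewrite (cond_exp_pull_out mX g_given_X mf)// ?RintegralZr//.
have := integrable_EFinZ (\int[P]_w g (Y w)) fi.
by apply: eq_integrable => // w _ /=; rewrite mulrC.
Qed.

End independence.

(** * Averages of independent identically distributed variables *)

(** Chebyshev: the square of the sum has mean at most n C, because the cross
    terms vanish. *)
Lemma uncorrelated_average_le d (Om : measurableType d) (R : realType)
    (P : probability Om R) (n : nat) (F : 'I_n -> Om -> R) (C eps : R) :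
  (0 < n)%N -> 0 < eps ->
  (forall i, measurable_fun setT (F i)) ->
  (forall i, P.-integrable setT (EFin \o (fun w => F i w ^+ 2))) ->
  (forall i, \int[P]_w (F i w ^+ 2) <= C) ->
  (forall i j, i != j -> \int[P]_w (F i w * F j w) = 0) ->
  (P [set w | (eps < `|n%:R^-1 * \sum_(i < n) F i w|)%R]
     <= (C / (n%:R * eps ^+ 2))%:E)%E.
Proof.
move=> n0 eps0 mF F2 FC F0.
have nR : 0 < n%:R :> R by rewrite ltr0n.
have mS : measurable_fun setT (fun w => \sum_(i < n) F i w).
  exact: measurable_sum.
have FF i j : P.-integrable setT (EFin \o (fun w => F i w * F j w)).
  exact: square_integrable_mul.
have SE w : (\sum_(i < n) F i w) ^+ 2 = \sum_(i < n) \sum_(j < n) F i w * F j w.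
  by rewrite expr2 mulr_suml; apply: eq_bigr => i _; rewrite mulr_sumr.
have Si : P.-integrable setT (EFin \o (fun w => (\sum_(i < n) F i w) ^+ 2)).
  have : P.-integrable setT
      (EFin \o (fun w => \sum_(i < n) \sum_(j < n) F i w * F j w)).
    by apply: integrable_EFin_sum => i; exact: integrable_EFin_sum.
  by apply: eq_integrable => // w _ /=; rewrite SE.
have SC : \int[P]_w (\sum_(i < n) F i w) ^+ 2 <= n%:R * C.
  under eq_Rintegral do rewrite SE.
  rewrite Rintegral_sum; last by move=> i; exact: integrable_EFin_sum.
  rewrite (_ : n%:R * C = \sum_(i < n) C); last first.
    by rewrite sumr_const card_ord mulr_natl.
  apply: ler_sum => i _; rewrite Rintegral_sum// (bigD1 i)//= big1 ?addr0.
    by under eq_Rintegral do rewrite -expr2.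
  by move=> j ji; rewrite F0// eq_sym.
have tailE w : (eps < `|n%:R^-1 * \sum_(i < n) F i w|) =
    ((n%:R * eps) ^+ 2 < (\sum_(i < n) F i w) ^+ 2).
  rewrite -[in RHS](real_normK (num_real (\sum_(i < n) F i w))).
  rewrite ltr_pXn2r ?nnegrE//; last by rewrite ltW// mulr_gt0.
  by rewrite normrM gtr0_norm ?invr_gt0// mulrC ltr_pdivlMr// mulrC.
under eq_set do rewrite tailE.
apply: (le_trans (markov_ge0 (C := n%:R * C) _ _ _ _)).
- exact: measurable_funX.
- by rewrite exprn_gt0// mulr_gt0.
- by move=> w; exact: sqr_ge0.
- by rewrite -EFin_Rintegral// lee_fin.
rewrite lee_fin le_eqVlt; apply/orP; left; apply/eqP.
by field; rewrite !gt_eqF.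
Qed.

Section iid.
Context d d' (Om : measurableType d) (V : measurableType d') (R : realType).
Context (P : probability Om R) (n : nat) (S : 'I_n -> Om -> V) (S0 : Om -> V).
Hypothesis mS : forall i, measurable_fun setT (S i).
Hypothesis mS0 : measurable_fun setT S0.
Hypothesis n_gt0 : (0 < n)%N.
Hypothesis same : forall i A, measurable A -> P (S i @^-1` A) = P (S0 @^-1` A).
Hypothesis indep : forall A : 'I_n -> set V, (forall i, measurable (A i)) ->
  P [set w | forall i, A i (S i w)] = (\prod_(i < n) P (S i @^-1` A i))%E.

(** The product rule for the events A at i, B at j, and the sure event at all
    other indices. *)
Lemma pairwise_independent (i j : 'I_n) : i != j ->
  forall A B, measurable A -> measurable B ->
  (P (S i @^-1` A `&` S j @^-1` B) = P (S i @^-1` A) * P (S j @^-1` B))%E.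
Proof.
move=> ij A B mA mB.
pose C l := if l == i then A else if l == j then B else setT.
have mC l : measurable (C l) by rewrite /C; case: ifP => // _; case: ifP.
have Ci : C i = A by rewrite /C eqxx.
have Cj : C j = B by rewrite /C eq_sym (negbTE ij) eqxx.
have := indep mC.
rewrite (bigD1 i)//= (bigD1 j)/=; last by rewrite eq_sym.
rewrite Ci Cj big1 => [|l /andP[li lj]]; last first.
  by rewrite /C (negbTE li) (negbTE lj) preimage_setT probability_setT.
rewrite mule1 => <-; congr (P _); apply/seteqP; split => w /=.
  move=> [Aw Bw] l; rewrite /C.
  by case: eqP => [->//|_]; case: eqP => [->|].
by move=> CS; split; [rewrite -Ci|rewrite -Cj].
Qed.

Lemma iid_average_concentration (psi : V -> R) (C eps : R) :
  measurable_fun setT psi -> 0 < eps ->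
  P.-integrable setT (EFin \o (fun w => psi (S0 w) ^+ 2)) ->
  \int[P]_w (psi (S0 w) ^+ 2) <= C ->
  (P [set w | (eps <
       `|n%:R^-1 * \sum_(i < n) psi (S i w) - \int[P]_w psi (S0 w)|)%R]
     <= (C / (n%:R * eps ^+ 2))%:E)%E.
Proof.
move=> mpsi eps0 psi2 psiC; set theta := \int[P]_w psi (S0 w).
have mpsi0 := measurableT_comp mpsi mS0.
have psi1 : P.-integrable setT (EFin \o (fun w => psi (S0 w))).
  exact: square_integrable_integrable.
pose phi v := psi v - theta.
have mphi : measurable_fun setT phi by exact: measurable_funB.
have phi1 : P.-integrable setT (EFin \o (fun w => phi (S0 w))).
  by apply: integrable_EFinB => //; exact: integrable_EFin_cst.
have phi2E w : phi (S0 w) ^+ 2 =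
    psi (S0 w) ^+ 2 - (2 * theta * psi (S0 w) - theta ^+ 2).
  by rewrite /phi; ring.
have linI : P.-integrable setT
    (EFin \o (fun w => 2 * theta * psi (S0 w) - theta ^+ 2)).
  by apply: integrable_EFinB; [exact: integrable_EFinZ|exact: integrable_EFin_cst].
have phi2 : P.-integrable setT (EFin \o (fun w => phi (S0 w) ^+ 2)).
  have := integrable_EFinB psi2 linI.
  by apply: eq_integrable => // w _ /=; rewrite phi2E.
have phi0 : \int[P]_w phi (S0 w) = 0.
  rewrite RintegralB//; last exact: integrable_EFin_cst.
  by rewrite Rintegral_prob_cst subrr.
have mphi2 : measurable_fun setT (fun v => phi v ^+ 2) by exact: measurable_funX.
have phiS i := same_law_integrable (mS i) mS0 (@same i) mphi phi1.
have phi2S i := same_law_integrable (mS i) mS0 (@same i) mphi2 phi2.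
have -> : [set w | eps < `|n%:R^-1 * \sum_(i < n) psi (S i w) - theta|] =
          [set w | eps < `|n%:R^-1 * \sum_(i < n) phi (S i w)|].
  apply: eq_set => w; rewrite sumrB sumr_const card_ord.
  by rewrite mulrBr -[theta *+ n]mulr_natl mulKf// pnatr_eq0 -lt0n.
apply: uncorrelated_average_le => //.
- by move=> i; exact: (measurableT_comp mphi (mS i)).
- move=> i; rewrite (same_law_Rintegral (mS i) mS0 (@same i) mphi2)//.
  apply: le_trans psiC; under eq_Rintegral do rewrite phi2E.
  rewrite RintegralB// gerBl RintegralB//; last 2 first.
    exact: integrable_EFinZ.
    exact: integrable_EFin_cst.
  rewrite RintegralZl// Rintegral_prob_cst -/theta.
  by rewrite (_ : _ - _ = theta ^+ 2) ?sqr_ge0//; ring.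
- move=> i j ij.
  rewrite (independent_Rintegral_mul (mS i) (mS j) (pairwise_independent ij))//.
    by rewrite (same_law_Rintegral (mS i) mS0 (@same i))// phi0 mul0r.
  by apply: square_integrable_mul => //; exact: (measurableT_comp mphi (mS _)).
Qed.

Lemma iid_average_markov (f : V -> R) (C K : R) :
  measurable_fun setT f -> (forall v, 0 <= f v) -> 0 < K ->
  P.-integrable setT (EFin \o (fun w => f (S0 w))) ->
  \int[P]_w f (S0 w) <= C ->
  (P [set w | (K < n%:R^-1 * \sum_(i < n) f (S i w))%R] <= (C / K)%:E)%E.
Proof.
move=> mf f0 K0 fi fC.
have fS i := same_law_integrable (mS i) mS0 (@same i) mf fi.
have Si := integrable_EFin_sum (index_enum 'I_n) fS.
apply: markov_ge0 => //.
- exact: integrable_measurable (integrable_EFinZ n%:R^-1 Si).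
- by move=> w; rewrite mulr_ge0// sumr_ge0.
rewrite -EFin_Rintegral; last exact: (integrable_EFinZ n%:R^-1 Si).
rewrite lee_fin RintegralZl// Rintegral_sum//.
under eq_bigr do rewrite (same_law_Rintegral (mS _) mS0 (@same _) mf)//.
by rewrite sumr_const card_ord -[X in _ * X]mulr_natl mulKf// pnatr_eq0 -lt0n.
Qed.

End iid.

(** * Identification of the mean potential outcome *)

Section identification.
Context d d' (Om : measurableType d) (V : measurableType d') (R : realType).
Context (P : probability Om R) (D : Om -> nat) (X : Om -> V) (t : nat).
Hypotheses (mD : measurable_fun setT D) (mX : measurable_fun setT X).

Let Z w := (D w, X w).

Let mZ : measurable_fun setT Z.
Proof. exact: measurable_fun_pair. Qed.

Definition inverse_weight (q : V -> R) (z : nat * V) : R :=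
  (z.1 == t)%:R / q z.2.

Lemma measurable_inverse_weight q : measurable_fun setT q ->
  measurable_fun setT (inverse_weight q).
Proof.
move=> mq; apply: measurable_funM.
  have mt : measurable_fun [set: nat] (fun s => (s == t)%:R : R) by [].
  exact: (measurableT_comp mt (@measurable_fst _ _ _ _)).
by apply: measurable_funV; exact: (measurableT_comp mq (@measurable_snd _ _ _ _)).
Qed.

Section weight.
Variables (q : V -> R) (qmin : R).
Hypotheses (mq : measurable_fun setT q) (qmin0 : 0 < qmin).
Hypothesis q_ge : {ae P, forall w, qmin <= q (X w)}.

Lemma inverse_weight_le :
  {ae P, forall w, 0 <= inverse_weight q (Z w) <= qmin^-1}.
Proof.
apply: filterS q_ge => w qw.
have q0 : 0 < q (X w) by exact: lt_le_trans qw.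
rewrite /inverse_weight/=; case: (D w == t); last first.
  by rewrite mul0r lexx invr_ge0 ltW.
by rewrite mul1r invr_ge0 (ltW q0)/= lef_pV2.
Qed.

Lemma integrable_inverse_weight (f : Om -> R) :
  P.-integrable setT (EFin \o f) ->
  P.-integrable setT (EFin \o (fun w => inverse_weight q (Z w) * f w)).
Proof.
move=> fi; apply: (ae_le_integrable _ (integrable_EFinZ qmin^-1 fi)).
  apply: measurable_funM; last exact: integrable_measurable fi.
  exact: (measurableT_comp (measurable_inverse_weight mq) mZ).
apply: filterS inverse_weight_le => w /andP[e0 e1].
by rewrite [leLHS]normrM [leRHS]normrM ler_wpM2r// !ger0_norm// invr_ge0 ltW.
Qed.

End weight.

Variables (Y W : Om -> R) (p g : V -> R) (h mu : nat * V -> R) (pmin : R).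
Hypothesis p_cond : is_cond_exp P X (fun w => (D w == t)%:R) p.
Hypotheses (pmin0 : 0 < pmin) (p_ge : {ae P, forall w, pmin <= p (X w)}).
Hypothesis g_cond : is_cond_exp P X Y g.
Hypothesis h_cond : is_cond_exp P Z Y h.
Hypothesis hg : {ae P, forall w, h (Z w) = g (X w)}.
Hypothesis mu_cond : is_cond_exp P Z W mu.
Hypothesis WY : forall w, D w = t -> W w = Y w.

Let mp : measurable_fun setT p. Proof. by case: p_cond. Qed.
Let Yi : P.-integrable setT (EFin \o Y). Proof. by case: g_cond. Qed.

(** Weighting by a / p X undoes the selection of the treated units:
    conditionally on X, a has mean p X. *)
Lemma Rintegral_inverse_propensity (f : V -> R) : measurable_fun setT f ->
  P.-integrable setT (EFin \o (fun w => f (X w))) ->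
  \int[P]_w (inverse_weight p (Z w) * f (X w)) = \int[P]_w f (X w).
Proof.
move=> mf fi.
have mfX := measurableT_comp mf mX.
have mfp : measurable_fun setT (fun x => f x / p x).
  by apply: measurable_funM => //; exact: measurable_funV.
have fpp : {ae P, forall w, f (X w) / p (X w) * p (X w) = f (X w)}.
  apply: filterS p_ge => w pw; rewrite divfK//.
  by rewrite gt_eqF//; exact: lt_le_trans pw.
have mfpp : measurable_fun setT (fun w => f (X w) / p (X w) * p (X w)).
  apply: measurable_funM; last exact: (measurableT_comp mp mX).
  exact: (measurableT_comp mfp mX).
rewrite -[RHS](ae_eq_Rintegral mfpp mfX fpp).
rewrite -(cond_exp_pull_out mX p_cond mfp).
- by apply: eq_Rintegral => w _; rewrite /inverse_weight/=; ring.
- have := integrable_inverse_weight mp pmin0 p_ge fi.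
  by apply: eq_integrable => // w _ /=; rewrite /inverse_weight/=; congr EFin; ring.
- apply: (ae_le_integrable mfpp fi).
  by apply: filterS fpp => w ->.
Qed.

Section any_weight.
Variables (q : V -> R) (qmin : R).
Hypotheses (mq : measurable_fun setT q) (qmin0 : 0 < qmin).
Hypothesis q_ge : {ae P, forall w, qmin <= q (X w)}.

Let mw := measurable_inverse_weight mq.
Let mwZ := measurableT_comp mw mZ.

(** The weight is a function of (D, X), and given (D, X) the potential outcome
    has the same mean as given X alone. *)
Lemma inverse_weight_unconfounded :
  \int[P]_w (inverse_weight q (Z w) * Y w) =
  \int[P]_w (inverse_weight q (Z w) * g (X w)).
Proof.
have [mh _ hi _] := h_cond; have [mg _ gi _] := g_cond.
rewrite (cond_exp_pull_out mZ h_cond mw).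
- apply: ae_eq_Rintegral.
  + by apply: measurable_funM => //; exact: (measurableT_comp mh mZ).
  + by apply: measurable_funM => //; exact: (measurableT_comp mg mX).
  + by apply: filterS hg => w ->.
- exact: (integrable_inverse_weight mq qmin0 q_ge).
- exact: (integrable_inverse_weight mq qmin0 q_ge).
Qed.

(** The weight vanishes off D = t, where alone the observed outcome and the
    potential outcome differ and the regression is taken at another level. *)
Lemma inverse_weight_regression :
  \int[P]_w (inverse_weight q (Z w) * Y w) =
  \int[P]_w (inverse_weight q (Z w) * mu (t, X w)).
Proof.
have [mmu Wi mui _] := mu_cond.
have onT (f f' : Om -> R) : (forall w, D w = t -> f w = f' w) ->
    forall w, inverse_weight q (Z w) * f w = inverse_weight q (Z w) * f' w.
  move=> ff' w; rewrite /inverse_weight/=.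
  by have [/ff' ->//|_] := eqVneq (D w) t; rewrite !mul0r.
transitivity (\int[P]_w (inverse_weight q (Z w) * W w)).
  by apply: eq_Rintegral => w _; apply: (onT Y W) => w' /WY.
rewrite (cond_exp_pull_out mZ mu_cond mw).
- by apply: eq_Rintegral => w _; apply: (onT (mu \o Z) (fun w => mu (t, X w))) => w' /= <-.
- exact: (integrable_inverse_weight mq qmin0 q_ge).
- exact: (integrable_inverse_weight mq qmin0 q_ge).
Qed.

End any_weight.

Lemma inverse_propensity_mean :
  \int[P]_w (inverse_weight p (Z w) * Y w) = \int[P]_w Y w.
Proof.
have [mg _ gi gE] := g_cond.
rewrite (inverse_weight_unconfounded mp pmin0 p_ge).
rewrite Rintegral_inverse_propensity//.
by have := gE setT measurableT; rewrite preimage_setT /Rintegral => ->.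
Qed.

Variables (p0 mu0 : V -> R) (pmin' : R).
Hypotheses (mp0 : measurable_fun setT p0) (mmu0 : measurable_fun setT mu0).
Hypotheses (pmin'0 : 0 < pmin') (p0_ge : {ae P, forall w, pmin' <= p0 (X w)}).

(** The augmented inverse probability weighting score; at the true p0 and mu0
    it is the uncentred efficient influence function of E[Y(t)]. *)
Definition score (o : R * nat * V) : R :=
  inverse_weight p0 (o.1.2, o.2) * (o.1.1 - mu0 o.2) + mu0 o.2.

(** With p0 = p the terms in mu0 cancel; with mu0 = mu_t the weighted residual
    has mean zero under any weight, and the weight p recovers E[Y(t)] from
    the regression. *)
Lemma double_robustness :
  P.-integrable setT (EFin \o (fun w => mu0 (X w))) ->
  {ae P, forall w, p0 (X w) = p (X w)} \/
  {ae P, forall w, mu0 (X w) = mu (t, X w)} ->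
  \int[P]_w score (Y w, D w, X w) = \int[P]_w Y w.
Proof.
move=> mu0i correct.
have mmu0X := measurableT_comp mmu0 mX.
have mw0 := measurableT_comp (measurable_inverse_weight mp0) mZ.
have mw := measurableT_comp (measurable_inverse_weight mp) mZ.
have wYi := integrable_inverse_weight mp0 pmin'0 p0_ge Yi.
have wmi := integrable_inverse_weight mp0 pmin'0 p0_ge mu0i.
rewrite /score/= RintegralD//; last first.
  have := integrable_EFinB wYi wmi.
  by apply: eq_integrable => // w _ /=; rewrite mulrBr.
under eq_Rintegral do rewrite mulrBr.
rewrite RintegralB//.
case: correct => [p0p|mu0mu].
  have wE : {ae P, forall w,
      inverse_weight p0 (Z w) = inverse_weight p (Z w)}.
    by apply: filterS p0p => w; rewrite /inverse_weight/= => ->.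
  have mY := integrable_measurable Yi.
  rewrite (ae_eq_Rintegral (g := fun w => inverse_weight p (Z w) * Y w)).
  - rewrite (ae_eq_Rintegral (f := fun w => inverse_weight p0 (Z w) * mu0 (X w))
      (g := fun w => inverse_weight p (Z w) * mu0 (X w))).
    + by rewrite inverse_propensity_mean Rintegral_inverse_propensity// subrK.
    + exact: measurable_funM.
    + exact: measurable_funM.
    + by apply: filterS wE => w ->.
  - exact: measurable_funM.
  - exact: measurable_funM.
  - by apply: filterS wE => w ->.
have [mmu _ _ _] := mu_cond.
have mmuX : measurable_fun setT (fun w => mu (t, X w)).
  by apply: (measurableT_comp mmu); exact: measurable_fun_pair.
have regr (q : V -> R) (qmin : R) : measurable_fun setT q -> 0 < qmin ->
    {ae P, forall w, qmin <= q (X w)} ->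
    \int[P]_w (inverse_weight q (Z w) * mu0 (X w)) =
    \int[P]_w (inverse_weight q (Z w) * Y w).
  move=> mq q0 q_ge; rewrite (inverse_weight_regression mq q0 q_ge).
  have mwq := measurableT_comp (measurable_inverse_weight mq) mZ.
  apply: ae_eq_Rintegral; [exact: measurable_funM|exact: measurable_funM|].
  by apply: filterS mu0mu => w ->.
rewrite (regr _ _ mp0 pmin'0 p0_ge) subrr add0r.
rewrite -Rintegral_inverse_propensity// (regr _ _ mp pmin0 p_ge).
exact: inverse_propensity_mean.
Qed.

End identification.

(** The score reads the outcome at treated units only, so the observed and the
    potential outcome are interchangeable in it. *)
Lemma score_treated d (V : measurableType d) (R : realType) t (p0 mu0 : V -> R)
    (y y' : R) s x : (s = t -> y = y') ->
  score t p0 mu0 (y, s, x) = score t p0 mu0 (y', s, x).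
Proof.
rewrite /score/inverse_weight/= => yy'.
by have [/yy' ->//|_] := eqVneq s t; rewrite !mul0r.
Qed.

Lemma measurable_score d (V : measurableType d) (R : realType) t
    (p0 mu0 : V -> R) :
  measurable_fun setT p0 -> measurable_fun setT mu0 ->
  measurable_fun setT (score t p0 mu0).
Proof.
move=> mp0 mmu0.
have mx : measurable_fun setT (fun o : R * nat * V => o.2) by exact: measurable_snd.
have my : measurable_fun setT (fun o : R * nat * V => o.1.1).
  exact: (measurableT_comp (@measurable_fst _ _ _ _) (@measurable_fst _ _ _ _)).
have ms : measurable_fun setT (fun o : R * nat * V => o.1.2).
  exact: (measurableT_comp (@measurable_snd _ _ _ _) (@measurable_fst _ _ _ _)).
have mm := measurableT_comp mmu0 mx.
apply: measurable_funD => //; apply: measurable_funM.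
  apply: (measurableT_comp (measurable_inverse_weight t mp0)).
  exact: measurable_fun_pair.
exact: measurable_funB.
Qed.

(** * Effect of the first stages on the estimator *)

(** The scale lam lets a factor that is only bounded be paired with one that is
    small: u is averaged against lam, v against 1 / lam. *)
Lemma young_le (R : realType) (lam u v : R) : 0 < lam ->
  `|u * v| <= lam * u ^+ 2 + lam^-1 * v ^+ 2.
Proof.
move=> l0; rewrite normrM -[u ^+ 2]real_normK ?num_real//.
rewrite -[v ^+ 2]real_normK ?num_real//.
have := normr_ge0 u; have := normr_ge0 v; move: `|u| `|v| => a b b0 a0.
have ab0 : 0 <= a * b by exact: mulr_ge0.
rewrite -(ler_pM2l l0) mulrDr (mulrA lam lam^-1) mulfV ?gt_eqF// mul1r.
have := sqr_ge0 (lam * a - b).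
have := mulr_ge0 (ltW l0) ab0.
nra.
Qed.

(** With a = 1 the difference is (y - m0) (1/p1 - 1/p0) + (m1 - m0) (1 - 1/p1),
    and |1/p1 - 1/p0| <= |p1 - p0| / (c pmin); with a = 0 only m1 - m0 is
    left. Young's inequality bounds each product. *)
Lemma summand_perturbation (R : realType) (a y m0 m1 p0 p1 c pmin lam : R) :
  0 < c -> 0 < pmin -> 0 < lam -> (a = 0 \/ a = 1 /\ c <= `|p1|) -> pmin <= p0 ->
  `|(a * (y - m1) / p1 + m1) - (a / p0 * (y - m0) + m0)| <=
  (c * pmin)^-1 * (lam * (a * (y - m0) ^+ 2) + lam^-1 * (p1 - p0) ^+ 2)
  + (1 + c^-1) * (lam + lam^-1 * (m1 - m0) ^+ 2).
Proof.
move=> c0 pmin0 l0 ha pp0.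
have p00 : 0 < p0 by exact: lt_le_trans pp0.
have k0 : 0 < (c * pmin)^-1 by rewrite invr_gt0 mulr_gt0.
have ci0 : 0 < c^-1 by rewrite invr_gt0.
have mE : `|m1 - m0| <= lam + lam^-1 * (m1 - m0) ^+ 2.
  by have := young_le 1 (m1 - m0) l0; rewrite mul1r expr1n mulr1.
have mE0 : 0 <= lam + lam^-1 * (m1 - m0) ^+ 2 by exact: le_trans mE.
case: ha => [->|[-> cp1]].
  rewrite !mul0r !add0r mulr0 add0r; apply: le_trans mE _.
  apply: le_trans (_ : (1 + c^-1) * (lam + lam^-1 * (m1 - m0) ^+ 2) <= _).
    by rewrite ler_peMl// lerDl ltW.
  rewrite lerDr; apply: mulr_ge0; first exact: ltW.
  by apply: mulr_ge0; rewrite ?sqr_ge0// invr_ge0 ltW.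
have p1n0 : p1 != 0 by rewrite -normr_gt0; exact: lt_le_trans cp1.
have -> : 1 * (y - m1) / p1 + m1 - (1 / p0 * (y - m0) + m0) =
    - ((y - m0) * (p1 - p0)) / (p1 * p0) + (m1 - m0) * (1 - p1^-1).
  by field; rewrite p1n0 gt_eqF.
apply: le_trans (ler_normD _ _) _; apply: lerD.
  rewrite normrM normrN mulrC mul1r; apply: ler_pM => //; last exact: young_le.
  rewrite normfV normrM (gtr0_norm p00) lef_pV2 ?posrE ?mulr_gt0 ?normr_gt0//.
  by apply: ler_pM => //; exact: ltW.
rewrite normrM mulrC; apply: ler_pM => //.
apply: le_trans (ler_normB _ _) _; rewrite normr1 lerD2l normfV.
by rewrite lef_pV2 ?posrE// normr_gt0.
Qed.

Lemma average_perturbation (R : realType) (n : nat) (a y m0 m1 p0 p1 : 'I_n -> R)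
    (theta c pmin lam : R) :
  (0 < n)%N -> 0 < c -> 0 < pmin -> 0 < lam ->
  (forall i, a i = 0 \/ a i = 1 /\ c <= `|p1 i|) -> (forall i, pmin <= p0 i) ->
  `|n%:R^-1 * \sum_i (a i * (y i - m1 i) / p1 i + m1 i) - theta| <=
  `|n%:R^-1 * \sum_i (a i / p0 i * (y i - m0 i) + m0 i) - theta|
  + ((c * pmin)^-1 * (lam * (n%:R^-1 * \sum_i (a i * (y i - m0 i) ^+ 2))
                      + lam^-1 * (n%:R^-1 * \sum_i (p1 i - p0 i) ^+ 2))
     + (1 + c^-1) * (lam + lam^-1 * (n%:R^-1 * \sum_i (m1 i - m0 i) ^+ 2))).
Proof.
move=> n0 c0 pmin0 l0 ha hp.
have nR : 0 < n%:R :> R by rewrite ltr0n.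
set s1 := \sum_i (a i * _ / _ + _); set s0 := \sum_i (a i / _ * _ + _).
have -> : n%:R^-1 * s1 - theta = (n%:R^-1 * s0 - theta) + n%:R^-1 * (s1 - s0).
  by ring.
apply: le_trans (ler_normD _ _) _; rewrite lerD2l normrM gtr0_norm ?invr_gt0//.
rewrite mulrC ler_pdivrMr// /s1 /s0 -sumrB.
apply: le_trans (ler_norm_sum _ _ _) _.
apply: le_trans (ler_sum _ (fun i _ =>
  summand_perturbation (y i) (m0 i) (m1 i) c0 pmin0 l0 (ha i) (hp i))) _.
rewrite big_split/= -!mulr_sumr !big_split/= -!mulr_sumr sumr_const card_ord.
rewrite -[lam *+ n]mulr_natr le_eqVlt; apply/orP; left; apply/eqP.
by field; rewrite !gt_eqF.
Qed.

(** * Moments and tails for one data generating process *)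

Section one_dgp.
Context (R : realType) (T k n : nat) (M : dgp R T k n) (t : nat).
Hypothesis t_le : (t <= T)%N.
Local Notation P := (dgp_law M).

Lemma outcome_treated (w : sample_space M) : treatment M w = t ->
  outcome w = potential M t w.
Proof.
move=> Dt; have tT : (t < T.+1)%N by [].
rewrite /outcome (bigD1 (Ordinal tT))//= Dt eqxx mul1r big1 ?addr0// => s.
rewrite -val_eqE/= => st; rewrite (_ : (t == s) = false) ?mul0r//.
by rewrite eq_sym; exact: negbTE.
Qed.

Lemma measurable_level s : measurable_fun setT (fun w => (treatment M w == s)%:R : R).
Proof.
have ms : measurable_fun [set: nat] (fun j => (j == s)%:R : R) by [].
exact: (measurableT_comp ms (measurable_funPT (treatment M))).
Qed.

Lemma measurable_population : measurable_fun setT (@population _ _ _ _ M).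
Proof.
apply: measurable_fun_pair; last exact: measurable_funPT.
apply: measurable_fun_pair; last exact: measurable_funPT.
apply: measurable_sum => s; apply: measurable_funM; first exact: measurable_level.
exact: (measurable_funPT (potential M s)).
Qed.

End one_dgp.

Section one_dgp_moments.
Context (R : realType) (T k n : nat) (M : dgp R T k n) (t : nat).
Hypothesis t_le : (t <= T)%N.
Hypothesis M_iid : iid_sample M.
Local Notation P := (dgp_law M).
Local Notation X := (covariate M).
Local Notation Y := (potential M t).

Let mX : measurable_fun setT X := measurable_funPT X.
Let mY : measurable_fun setT Y := measurable_funPT Y.
Let mD : measurable_fun setT (treatment M) := measurable_funPT (treatment M).
Let mS i : measurable_fun setT (sample M i) := measurable_funPT (sample M i).

Lemma measurable_x_ i : measurable_fun setT (@x_ _ _ _ _ M i).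
Proof. exact: (measurableT_comp (@measurable_snd _ _ _ _) (mS i)). Qed.

Lemma measurable_y_ i : measurable_fun setT (@y_ _ _ _ _ M i).
Proof.
exact: (measurableT_comp (@measurable_fst _ _ _ _)
  (measurableT_comp (@measurable_fst _ _ _ _) (mS i))).
Qed.

Lemma measurable_d_ i : measurable_fun setT (@d_ _ _ _ _ M i).
Proof.
exact: (measurableT_comp (@measurable_snd _ _ _ _)
  (measurableT_comp (@measurable_fst _ _ _ _) (mS i))).
Qed.

(** Since a <= 1 + a^(1+r) for a >= 0, the second moment inherits the bound;
    equality in law carries it from a sample point to the population. *)
Lemma regression_second_moment (f : covariates R k -> R) (i : 'I_n) (r B : R) :
  measurable_fun setT f -> 0 < r ->
  ('E_P[fun w : sample_space M => (`|f (x_ i w) * f (x_ i w)| `^ (1 + r))%R] <= B%:E)%E ->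
  P.-integrable setT (EFin \o (fun w => f (X w) ^+ 2)) /\
  \int[P]_w (f (X w) ^+ 2) <= 1 + B.
Proof.
move=> mf r0; rewrite unlock => fB.
have mo : measurable_fun setT (fun o : observation R k => f o.2 ^+ 2).
  by apply: measurable_funX; exact: (measurableT_comp mf (@measurable_snd _ _ _ _)).
have mfx : measurable_fun setT (fun w : sample_space M => f (x_ i w)).
  exact: (measurableT_comp mf (measurable_x_ i)).
have same A : measurable A -> P (@population _ _ _ _ M @^-1` A) =
    P (sample M i @^-1` A).
  by move=> mA; rewrite (proj1 M_iid).
have [xi xB] : P.-integrable setT (EFin \o (fun w : sample_space M => f (x_ i w) ^+ 2)) /\
    \int[P]_w (f (x_ i w) ^+ 2) <= 1 + B.
  apply: integrable_le_1D fB => //.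
  - exact: measurable_funX.
  - apply: (measurableT_comp (measurable_powR (1 + r))).
    by apply: measurableT_comp => //; exact: measurable_funM.
  - by move=> w; exact: sqr_ge0.
  move=> w; rewrite -expr2 ger0_norm ?sqr_ge0//.
  have [a1|a1] := leP (f (x_ i w) ^+ 2) 1.
    by apply: le_trans a1 _; rewrite lerDl powR_ge0.
  apply: le_trans (_ : (f (x_ i w) ^+ 2) `^ (1 + r) <= _); last by rewrite lerDr.
  rewrite -[leLHS]powRr1 ?sqr_ge0// ler_powR ?(ltW a1)//.
  by rewrite lerDl ltW.
have mpop := @measurable_population _ _ _ _ M.
split; first exact: (same_law_integrable mpop (mS i) same mo xi).
by have /= -> := same_law_Rintegral mpop (mS i) same mo xi.
Qed.

Lemma residual_second_moment (mu0 : covariates R k -> R) (B : R)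
    (v : covariates R k -> R) :
  measurable_fun setT mu0 ->
  is_cond_exp P X (fun w => `|Y w - mu0 (X w)| ^+ 4) v ->
  {ae P, forall w, v (X w) <= B ^+ 4} ->
  P.-integrable setT (EFin \o (fun w => (Y w - mu0 (X w)) ^+ 2)) /\
  \int[P]_w ((Y w - mu0 (X w)) ^+ 2) <= 1 + B ^+ 4.
Proof.
move=> mmu0 [_ i4 vi vE] vB.
have mU : measurable_fun setT (fun w => Y w - mu0 (X w)).
  by apply: measurable_funB => //; exact: (measurableT_comp mmu0 mX).
have sq4 (u : R) : `|u| ^+ 4 = u ^+ 2 * u ^+ 2.
  by rewrite -exprD -normrX ger0_norm// exprn_even_ge0.
apply: (integrable_le_1D (g := fun w => `|Y w - mu0 (X w)| ^+ 4)) => //.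
- exact: measurable_funX.
- exact: integrable_measurable i4.
- by move=> w; exact: sqr_ge0.
- move=> w; rewrite sq4; have := sqr_ge0 (Y w - mu0 (X w)).
  by move: (_ ^+ 2) => a a0; have := sqr_ge0 (a - 1); nra.
have := vE setT measurableT; rewrite preimage_setT => ->.
rewrite -EFin_Rintegral// lee_fin -[leRHS](Rintegral_prob_cst P).
by apply: ae_le_Rintegral => //; exact: integrable_EFin_cst.
Qed.

Lemma score_population (p0 mu0 : covariates R k -> R) (w : sample_space M) :
  score t p0 mu0 (population w) = score t p0 mu0 (Y w, treatment M w, X w).
Proof. by apply: score_treated => Dt; exact: outcome_treated. Qed.

(** From (e u + v)^2 <= 2 e^2 u^2 + 2 v^2 with the weight e at most
    1 / pmin. *)
Lemma score_second_moment (p0 mu0 : covariates R k -> R) (pmin B C : R) :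
  measurable_fun setT p0 -> measurable_fun setT mu0 ->
  0 < pmin -> {ae P, forall w, pmin <= p0 (X w)} ->
  P.-integrable setT (EFin \o (fun w => (Y w - mu0 (X w)) ^+ 2)) ->
  \int[P]_w ((Y w - mu0 (X w)) ^+ 2) <= B ->
  P.-integrable setT (EFin \o (fun w => mu0 (X w) ^+ 2)) ->
  \int[P]_w (mu0 (X w) ^+ 2) <= C ->
  P.-integrable setT (EFin \o (fun w => score t p0 mu0 (population w) ^+ 2)) /\
  \int[P]_w (score t p0 mu0 (population w) ^+ 2) <=
    2 * pmin^-1 ^+ 2 * B + 2 * C.
Proof.
move=> mp0 mmu0 pmin0 p0_ge Ui UB mi mC.
have U'i := integrable_EFinZ (2 * pmin^-1 ^+ 2) Ui.
have m'i := integrable_EFinZ 2 mi.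
have mpsi := measurableT_comp (measurable_score t mp0 mmu0)
  (@measurable_population _ _ _ _ M).
have key (e u v : R) : 0 <= e <= pmin^-1 ->
    (e * u + v) ^+ 2 <= 2 * pmin^-1 ^+ 2 * u ^+ 2 + 2 * v ^+ 2.
  move=> /andP[e0 e1].
  have e2 : e ^+ 2 * u ^+ 2 <= pmin^-1 ^+ 2 * u ^+ 2.
    by rewrite ler_wpM2r ?sqr_ge0// ler_pXn2r// nnegrE invr_ge0 ltW.
  have -> : (e * u + v) ^+ 2 =
      2 * (e ^+ 2 * u ^+ 2) + 2 * v ^+ 2 - (e * u - v) ^+ 2 by ring.
  rewrite lerBlDr -addrA -mulrA; apply: lerD; first by rewrite ler_pM2l.
  by rewrite lerDl sqr_ge0.
have dom : {ae P, forall w, score t p0 mu0 (population w) ^+ 2 <=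
    2 * pmin^-1 ^+ 2 * (Y w - mu0 (X w)) ^+ 2 + 2 * mu0 (X w) ^+ 2}.
  apply: filterS (inverse_weight_le (treatment M) t pmin0 p0_ge) => w e01.
  by rewrite score_population; exact: key.
have si : P.-integrable setT
    (EFin \o (fun w => score t p0 mu0 (population w) ^+ 2)).
  apply: (ae_le_integrable _ (integrable_EFinD U'i m'i)).
    exact: measurable_funX.
  apply: filterS dom => w dw; rewrite ger0_norm ?sqr_ge0//.
  by apply: le_trans dw _; exact: ler_norm.
split => //.
apply: le_trans (ae_le_Rintegral si (integrable_EFinD U'i m'i) dom) _.
rewrite RintegralD// !RintegralZl//; apply: lerD; rewrite ler_wpM2l//.
by rewrite mulr_ge0// sqr_ge0.
Qed.

Lemma score_mean (p mu : nat -> covariates R k -> R) (p0 mu0 : covariates R k -> R)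
    (pmin pmin' : R) :
  is_propensity M p -> is_regression M mu -> unconfounded M ->
  measurable_fun setT p0 -> measurable_fun setT mu0 ->
  0 < pmin -> {ae P, forall w, pmin <= p t (X w)} ->
  0 < pmin' -> {ae P, forall w, pmin' <= p0 (X w)} ->
  P.-integrable setT (EFin \o (fun w => mu0 (X w))) ->
  {ae P, forall w, p0 (X w) = p t (X w)} \/
  {ae P, forall w, mu0 (X w) = mu t (X w)} ->
  \int[P]_w score t p0 mu0 (population w) = mean_potential M t.
Proof.
move=> pP muR unc mp0 mmu0 pmin0 p_ge pmin'0 p0_ge mi correct.
have [g [h [gc hc hg]]] := unc t t_le.
under eq_Rintegral do rewrite score_population.
rewrite /mean_potential unlock.
exact: (double_robustness mD mX (pP t t_le) pmin0 p_ge gc hc hg muR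
  (@outcome_treated _ _ _ _ M _ t_le) mp0 mmu0 pmin'0 p0_ge mi correct).
Qed.

End one_dgp_moments.

Section tail.
Context (R : realType) (T k n : nat) (M : dgp R T k n) (t : nat).
Hypothesis t_le : (t <= T)%N.
Hypothesis n_gt0 : (0 < n)%N.
Hypothesis M_iid : iid_sample M.
Variables (p mu : nat -> covariates R k -> R) (p0 mu0 : covariates R k -> R).
Variables (phat muhat : sample_space M -> covariates R k -> R).
Hypotheses (p_propensity : is_propensity M p) (mu_regression : is_regression M mu).
Hypothesis M_unconfounded : unconfounded M.
Hypotheses (mp0 : measurable_fun setT p0) (mmu0 : measurable_fun setT mu0).
Hypothesis mphat : forall i : 'I_n, measurable_fun setT (fun w => phat w (x_ i w)).
Hypothesis mmuhat : forall i : 'I_n, measurable_fun setT (fun w => muhat w (x_ i w)).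
Variables (pmin pmin0 : R).
Local Notation P := (dgp_law M).
Local Notation X := (covariate M).
Local Notation Y := (potential M t).
Hypotheses (pmin_gt0 : 0 < pmin) (p_ge : {ae P, forall w, pmin <= p t (X w)}).
Hypotheses (pmin0_gt0 : 0 < pmin0) (p0_ge : {ae P, forall w, pmin0 <= p0 (X w)}).
Hypothesis correct : {ae P, forall w, p0 (X w) = p t (X w)} \/
                     {ae P, forall w, mu0 (X w) = mu t (X w)}.
Variables (B C : R).
Hypothesis res_int : P.-integrable setT (EFin \o (fun w => (Y w - mu0 (X w)) ^+ 2)).
Hypothesis res_le : \int[P]_w ((Y w - mu0 (X w)) ^+ 2) <= B.
Hypothesis mu0_int : P.-integrable setT (EFin \o (fun w => mu0 (X w) ^+ 2)).
Hypothesis mu0_le : \int[P]_w (mu0 (X w) ^+ 2) <= C.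

Let mpop := @measurable_population _ _ _ _ M.
Let mS i : measurable_fun setT (sample M i) := measurable_funPT (sample M i).
Let mx := @measurable_x_ _ _ _ _ M.
Let my := @measurable_y_ _ _ _ _ M.
Let md := @measurable_d_ _ _ _ _ M.

Let mu0_int1 : P.-integrable setT (EFin \o (fun w => mu0 (X w))).
Proof.
apply: square_integrable_integrable mu0_int.
exact: (measurableT_comp mmu0 (measurable_funPT X)).
Qed.

Lemma score_average_tail (eps : R) : 0 < eps ->
  (P [set w | (eps < `|n%:R^-1 * \sum_(i < n) score t p0 mu0 (sample M i w)
                       - mean_potential M t|)%R]
   <= ((2 * pmin0^-1 ^+ 2 * B + 2 * C) / (n%:R * eps ^+ 2))%:E)%E.
Proof.
move=> eps0.
have [psi2 psiC] := score_second_moment t_le mp0 mmu0 pmin0_gt0 p0_ge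
  res_int res_le mu0_int mu0_le.
rewrite -(score_mean t_le p_propensity mu_regression M_unconfounded mp0 mmu0
  pmin_gt0 p_ge pmin0_gt0 p0_ge mu0_int1 correct).
have [same indep] := M_iid.
exact: (iid_average_concentration mS mpop n_gt0 same indep
  (measurable_score t mp0 mmu0) eps0 psi2 psiC).
Qed.

Lemma residual_average_tail (K : R) : 0 < K ->
  (P [set w | (K < n%:R^-1 *
      \sum_(i < n) (d_ i w == t)%:R * (y_ i w - mu0 (x_ i w)) ^+ 2)%R]
   <= (B / K)%:E)%E.
Proof.
move=> K0; pose f (o : observation R k) : R :=
  (o.1.2 == t)%:R * (o.1.1 - mu0 o.2) ^+ 2.
have mf : measurable_fun setT f.
  have mt : measurable_fun [set: nat] (fun s => (s == t)%:R : R) by [].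
  apply: measurable_funM.
    apply: (measurableT_comp mt).
    exact: (measurableT_comp (@measurable_snd _ _ _ _) (@measurable_fst _ _ _ _)).
  apply: measurable_funX; apply: measurable_funB.
    exact: (measurableT_comp (@measurable_fst _ _ _ _) (@measurable_fst _ _ _ _)).
  exact: (measurableT_comp mmu0 (@measurable_snd _ _ _ _)).
have f0 o : 0 <= f o by rewrite mulr_ge0// sqr_ge0.
have fle w : f (population w) <= (Y w - mu0 (X w)) ^+ 2.
  rewrite /f/=; have [/(outcome_treated t_le) ->|_] := eqVneq (treatment M w) t.
    by rewrite mul1r.
  by rewrite mul0r sqr_ge0.
have fi : P.-integrable setT (EFin \o (fun w => f (population w))).
  apply: (ae_le_integrable _ res_int); first exact: (measurableT_comp mf mpop).
  by apply: aeW => w; rewrite !ger0_norm ?sqr_ge0.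
have [same _] := M_iid.
apply: (iid_average_markov mS mpop n_gt0 same mf f0 K0 fi).
by apply: le_trans res_le; exact: le_Rintegral.
Qed.

(** Overlap in the population passes to each sample point by equality in law,
    and finitely many null sets have a null union. *)
Lemma sample_overlap : {ae P, forall w, forall i : 'I_n, pmin0 <= p0 (x_ i w)}.
Proof.
have [same _] := M_iid.
have mA : measurable [set o : observation R k | pmin0 <= p0 o.2].
  rewrite -[X in measurable X]setTI; apply: measurable_fun_ler => //.
  exact: (measurableT_comp mp0 (@measurable_snd _ _ _ _)).
have xi i : {ae P, forall w, pmin0 <= p0 (x_ i w)}.
  exact: (same_law_ae (mS i) mpop (same i) mA p0_ge).
(* Almost sure statements combine over a countable index; the indices that are
   not below n contribute an empty condition. *)
have all : {ae P, forall w, forall m (i : 'I_n), val i = m -> pmin0 <= p0 (x_ i w)}.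
  apply: ae_foralln => m; have [mn|mn] := ltnP m n.
    by apply: filterS (xi (Ordinal mn)) => w h i im; rewrite (_ : i = Ordinal mn)//; exact: val_inj.
  by apply: aeW => w i im; move: (ltn_ord i); rewrite im ltnNge mn.
by apply: filterS all => w h i; exact: (h i).
Qed.

Let mmse (f : sample_space M -> covariates R k -> R) g :
  (forall i : 'I_n, measurable_fun setT (fun w => f w (x_ i w))) ->
  measurable_fun setT g -> measurable_fun setT (sample_mse f g).
Proof.
move=> mf mg; apply: measurable_funM => //; apply: measurable_sum => i.
apply: measurable_funX; apply: measurable_funB => //.
exact: (measurableT_comp mg (mx i)).
Qed.

Let m_lt (f : sample_space M -> R) (a : R) : measurable_fun setT f ->
  measurable [set w | a < f w].
Proof.
by move=> mf; rewrite -[X in measurable X]setTI; exact: measurable_fun_ltr.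
Qed.

Let m_level i : measurable_fun setT (fun w : sample_space M => (d_ i w == t)%:R : R).
Proof.
have mt : measurable_fun [set: nat] (fun s => (s == t)%:R : R) by [].
exact: (measurableT_comp mt (md i)).
Qed.

(** Almost surely off five events the estimator is within eps of its target: a small fitted
    propensity at a treated point, a large average of the squared residuals, a
    large deviation of the average score, and a large mean square error of
    either first stage. The second and the third are bounded by the
    moment conditions; the others are left as they stand, to be made small by
    the assumptions on the first stages. *)
Lemma mean_estimator_tail (eps c K lam etap etam : R) :
  0 < eps -> 0 < c -> 0 < K -> 0 < lam ->
  (c * pmin0)^-1 * (lam * K + lam^-1 * etap)
    + (1 + c^-1) * (lam + lam^-1 * etam) <= eps / 2 ->
  (P [set w | (eps < `|(`|mean_estimator t phat muhat w - mean_potential M t|)|)%R]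
   <= P [set w | exists i : 'I_n, d_ i w = t /\ (`|phat w (x_ i w)| < c)%R]
      + (B / K)%:E
      + ((2 * pmin0^-1 ^+ 2 * B + 2 * C) / (n%:R * (eps / 2) ^+ 2))%:E
      + P [set w | (etap < `|sample_mse phat p0 w|)%R]
      + P [set w | (etam < `|sample_mse muhat mu0 w|)%R])%E.
Proof.
move=> eps0 c0 K0 lam0 small.
set A1 := [set w | exists i : 'I_n, _].
pose A2 := [set w : sample_space M | K < n%:R^-1 *
  \sum_(i < n) (d_ i w == t)%:R * (y_ i w - mu0 (x_ i w)) ^+ 2].
pose A3 := [set w | eps / 2 <
  `|n%:R^-1 * \sum_(i < n) score t p0 mu0 (sample M i w) - mean_potential M t|].
set A4 := [set w | etap < _]; set A5 := [set w | etam < _].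
have mmu0x i := measurableT_comp mmu0 (mx i).
have mA1 : measurable A1.
  rewrite (_ : A1 = \bigcup_(i in [set: 'I_n])
      ((fun w => d_ i w) @^-1` [set t] `&` [set w | `|phat w (x_ i w)| < c])).
    apply: fin_bigcup_measurable => // i _; apply: measurableI.
      by rewrite -[X in measurable X]setTI; exact: md.
    rewrite -[X in measurable X]setTI; apply: measurable_fun_ltr => //.
    exact: measurableT_comp.
  apply/seteqP; split => w; first by move=> [i [di pi]]; exists i.
  by move=> [i _ [di pi]]; exists i.
have mA2 : measurable A2.
  apply: m_lt; apply: measurable_funM => //; apply: measurable_sum => i.
  apply: measurable_funM => //; apply: measurable_funX.
  exact: measurable_funB (my i) (mmu0x i).
have mA3 : measurable A3.
  apply: m_lt; apply: measurableT_comp => //; apply: measurable_funB => //.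
  apply: measurable_funM => //; apply: measurable_sum => i.
  exact: (measurableT_comp (measurable_score t mp0 mmu0) (mS i)).
have mA4 : measurable A4.
  by apply: m_lt; apply: measurableT_comp => //; exact: mmse.
have mA5 : measurable A5.
  by apply: m_lt; apply: measurableT_comp => //; exact: mmse.
have [N [mN N0 subN]] := sample_overlap.
have mE : measurable
    [set w | eps < `|(`|mean_estimator t phat muhat w - mean_potential M t|)|].
  apply: m_lt; do 2 apply: measurableT_comp => //; apply: measurable_funB => //.
  apply: measurable_funM => //; apply: measurable_sum => i.
  apply: measurable_funD => //; apply: measurable_funM.
    by apply: measurable_funM => //; exact: measurable_funB (my i) (mmuhat i).
  exact: measurable_funV.
have sub : [set w | eps < `|(`|mean_estimator t phat muhat w - mean_potential M t|)|]
    `<=` A1 `|` A2 `|` A3 `|` A4 `|` A5 `|` N.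
  move=> w /=; rewrite normr_id => far; apply: contrapT => /not_orP[].
  move=> /not_orP[/not_orP[/not_orP[/not_orP[n1 n2] n3] n4] n5] nN.
  have p0x : forall i : 'I_n, pmin0 <= p0 (x_ i w).
    by apply: contrapT => h; apply: nN; exact: subN.
  have a01 i : (d_ i w == t)%:R = 0 :> R \/
      (d_ i w == t)%:R = 1 :> R /\ c <= `|phat w (x_ i w)|.
    have [dt|_] := eqVneq (d_ i w) t; [right; split => //|by left].
    by rewrite leNgt; apply/negP => pc; apply: n1; exists i.
  move: n2 n3 n4 n5; rewrite /A2 /A3 /A4 /A5 /=.
  move=> /negP; rewrite -leNgt => n2 /negP; rewrite -leNgt => n3.
  move=> /negP; rewrite -leNgt => n4 /negP; rewrite -leNgt => n5.
  have {}n4 := le_trans (ler_norm _) n4; have {}n5 := le_trans (ler_norm _) n5.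
  have := average_perturbation (fun i => y_ i w) (fun i => mu0 (x_ i w))
    (fun i => muhat w (x_ i w)) (mean_potential M t) n_gt0 c0 pmin0_gt0 lam0
    a01 p0x.
  apply/negP; rewrite -ltNge; apply: le_lt_trans far.
  rewrite [leRHS]splitr; apply: lerD; first exact: n3.
  apply: le_trans small.
  have kap0 : 0 <= (c * pmin0)^-1 by rewrite invr_ge0 mulr_ge0 ?ltW.
  have kap1 : 0 <= 1 + c^-1 by rewrite addr_ge0// invr_ge0 ltW.
  have li : 0 <= lam^-1 by rewrite invr_ge0 ltW.
  apply: lerD; apply: ler_wpM2l => //; apply: lerD => //.
  - by apply: ler_wpM2l => //; exact: ltW.
  - exact: ler_wpM2l.
  - exact: ler_wpM2l.
have mU4 : measurable (A1 `|` A2) by exact: measurableU.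
have mU3 : measurable (A1 `|` A2 `|` A3) by exact: measurableU.
have mU2 : measurable (A1 `|` A2 `|` A3 `|` A4) by exact: measurableU.
have mU1 : measurable (A1 `|` A2 `|` A3 `|` A4 `|` A5) by exact: measurableU.
have mU0 : measurable (A1 `|` A2 `|` A3 `|` A4 `|` A5 `|` N) by exact: measurableU.
apply: (le_trans (le_measure P _ _ sub)); rewrite ?inE//.
apply: (le_trans (measureU2 P mU1 mN)); rewrite [X in (_ + X)%E]N0 adde0.
apply: (le_trans (measureU2 P mU2 mA5)); apply: leeD => //.
apply: (le_trans (measureU2 P mU3 mA4)); apply: leeD => //.
apply: (le_trans (measureU2 P mU4 mA3)); apply: leeD => //; last first.
  by apply: score_average_tail; rewrite divr_gt0.
apply: (le_trans (measureU2 P mA1 mA2)); apply: leeD => //.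
exact: residual_average_tail.
Qed.

End tail.

(** * Consistency *)

Theorem theorem2 (R : realType) (T : nat) (T_ge1 : (1 <= T)%N)
    (t : nat) (t_le : (t <= T)%N)
    (k : nat -> nat) (q : nat -> nat)
    (Xstar : forall n, 'I_(q n) -> {mfun covariates R (k n) >-> measurableTypeR R})
    (M : forall n, dgp R T (k n) n)
    (p mu : forall n, nat -> covariates R (k n) -> R)
    (p0 mu0 : forall n, {mfun covariates R (k n) >-> measurableTypeR R})
    (phat muhat : forall n, sample_space (M n) -> covariates R (k n) -> R)
    (p_propensity : forall n, is_propensity (M n) (p n))
    (mu_regression : forall n, is_regression (M n) (mu n))
    (phat_estimator : first_stage_estimator phat)
    (muhat_estimator : first_stage_estimator muhat)
    (phat_bounded_away : inverse_weights_bounded t phat)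
    (phat_limit : o_P1 (fun n => sample_mse (phat n) (p0 n)))
    (muhat_limit : o_P1 (fun n => sample_mse (muhat n) (mu0 n)))
    (assumption_I_a : forall n, unconfounded (M n))
    (assumption_II_a : forall n, iid_sample (M n))
    (assumption_II_b : transformations_bounded M Xstar)
    (assumption_I_b_II_cde : regularity M Xstar p mu)
    (regularity0 : regularity M Xstar
       (fun n => replace_at t (p0 n) (p n))
       (fun n => replace_at t (mu0 n) (mu n)))
    (correct :
       (forall n, {ae dgp_law (M n), forall w,
          p0 n (covariate (M n) w) = p n t (covariate (M n) w)}) \/
       (forall n, {ae dgp_law (M n), forall w,
          mu0 n (covariate (M n) w) = mu n t (covariate (M n) w)})) :
  o_P1 (fun n w => `|mean_estimator t (phat n) (muhat n) w
                     - mean_potential (M n) t|).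
Proof.
have [[pmin pmin_gt0 p_ge] _ _ _] := assumption_I_b_II_cde.
have [[pmin0 pmin0_gt0 p0_ge] [B res4] _ [r r0 [B' moments]]] := regularity0.
pose BU := 1 + B ^+ 4; pose Bm := 1 + B'.
have BU_gt0 : 0 < BU by rewrite ltr_pwDl// exprn_even_ge0.
have P0 (n : nat) A : (0 <= dgp_law (M n) A)%E by exact: measure_ge0.
move=> eps eps0; apply/(cvge0P (fun n => P0 n _)) => delta delta0.
(* One fifth of delta for each of the five exceptional events. *)
pose e := delta / 5; have e0 : 0 < e by rewrite divr_gt0.
have [c c0 Hc] := phat_bounded_away e e0.
pose K := BU / e; have K0 : 0 < K by rewrite divr_gt0.
pose kap := (c * pmin0)^-1; have kap0 : 0 < kap by rewrite invr_gt0 mulr_gt0.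
pose kap' := 1 + c^-1; have kap'0 : 0 < kap' by rewrite addr_gt0// invr_gt0.
have D0 : 0 < kap * K + kap' by rewrite addr_gt0// mulr_gt0.
(* The terms proportional to lam then add up to eps / 4, and each of the two
   mean square errors contributes eps / 8. *)
pose lam := eps / (4 * (kap * K + kap')).
have lam0 : 0 < lam by rewrite divr_gt0// mulr_gt0.
pose etap := lam * eps / (8 * kap).
have etap0 : 0 < etap by rewrite divr_gt0// mulr_gt0.
pose etam := lam * eps / (8 * kap').
have etam0 : 0 < etam by rewrite divr_gt0// mulr_gt0.
have small : kap * (lam * K + lam^-1 * etap) + kap' * (lam + lam^-1 * etam)
    <= eps / 2.
  have -> : kap * (lam * K + lam^-1 * etap) + kap' * (lam + lam^-1 * etam) =
      lam * (kap * K + kap') + (lam^-1 * lam) * eps / 4.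
    by rewrite /etap /etam; field; rewrite !gt_eqF.
  rewrite mulVf ?gt_eqF// mul1r /lam.
  rewrite (_ : _ + _ = eps / 2)//; field.
  by rewrite gt_eqF.
pose V := 2 * pmin0^-1 ^+ 2 * BU + 2 * Bm.
have Hp := (cvge0P (fun n => P0 n _)).1 (phat_limit etap etap0) e e0.
have Hm := (cvge0P (fun n => P0 n _)).1 (muhat_limit etam etam0) e e0.
have Hn : \forall n \near \oo, V / (e * (eps / 2) ^+ 2) <= n%:R.
  exact: nbhs_infty_ger.
have Hn0 : \forall n \near \oo, (0 < n)%N by exact: nbhs_infty_gt.
near=> n.
have n0 : (0 < n)%N by near: n.
have mp0 : measurable_fun setT (p0 n) by exact: measurable_funPT.
have mmu0 : measurable_fun setT (mu0 n) by exact: measurable_funPT.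
have p0n_ge : {ae dgp_law (M n), forall w, pmin0 <= p0 n (covariate (M n) w)}.
  by have := p0_ge n t t_le; rewrite /replace_at eqxx.
have [res_int res_le] : (dgp_law (M n)).-integrable setT
      (EFin \o (fun w => (potential (M n) t w - mu0 n (covariate (M n) w)) ^+ 2)) /\
    \int[dgp_law (M n)]_w
      ((potential (M n) t w - mu0 n (covariate (M n) w)) ^+ 2) <= BU.
  have [v] := res4 n t t_le; rewrite /residual /replace_at eqxx => vc vB.
  exact: (residual_second_moment mmu0 vc vB).
have [mu0_int mu0_le] : (dgp_law (M n)).-integrable setT
      (EFin \o (fun w => mu0 n (covariate (M n) w) ^+ 2)) /\
    \int[dgp_law (M n)]_w (mu0 n (covariate (M n) w) ^+ 2) <= Bm.
  have [+ _] := moments n (Ordinal n0).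
  move=> /(_ t t t_le t_le); rewrite /replace_at eqxx.
  exact: (regression_second_moment (assumption_II_a n) mmu0 r0).
have correctn : {ae dgp_law (M n), forall w,
      p0 n (covariate (M n) w) = p n t (covariate (M n) w)} \/
    {ae dgp_law (M n), forall w,
      mu0 n (covariate (M n) w) = mu n t (covariate (M n) w)}.
  by case: correct => h; [left|right]; exact: h.
apply: le_trans (mean_estimator_tail t_le n0 (assumption_II_a n)
  (p_propensity n) (mu_regression n) (assumption_I_a n) mp0 mmu0
  (phat_estimator n) (muhat_estimator n) pmin_gt0 (p_ge n t t_le)
  pmin0_gt0 p0n_ge correctn res_int res_le mu0_int mu0_le
  eps0 c0 K0 lam0 small) _.
rewrite (_ : delta%:E = e%:E + e%:E + e%:E + e%:E + e%:E)%E; last first.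
  by rewrite -!EFinD /e; congr EFin; field.
apply: leeD; last by near: n.
apply: leeD; last by near: n.
apply: leeD; last first.
  have e2 : 0 < (eps / 2) ^+ 2 by rewrite exprn_gt0// divr_gt0.
  rewrite lee_fin -/V ler_pdivrMr ?mulr_gt0 ?ltr0n// mulrCA.
  by rewrite -ler_pdivrMr ?mulr_gt0//; near: n.
apply: leeD; first by near: n.
rewrite lee_fin /K le_eqVlt; apply/orP; left; apply/eqP.
by field; rewrite !gt_eqF.
Unshelve. all: by end_near. Qed.
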